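(* Let $\Omega\subset\mathbb C^n$ be a bounded open set and $q\in\mathbb R$, $q>1$. Suppose that for every $\eta\in\partial\Omega$ and every $\varepsilon>0$ there exists $f_{\eta,\varepsilon}\in\bigcap_{p<q}\mathcal{O}L^p(\Omega)$ with $\int_{B(\eta,\varepsilon)\cap\Omega}|f_{\eta,\varepsilon}|^q\,dv=+\infty$. Then the set $$\mathcal S(\Omega,q)=\Big\{g\in\bigcap_{p<q}\mathcal{O}L^p(\Omega): \int_{B(\zeta,\varepsilon)\cap\Omega}|g|^q\,dv=+\infty\ \text{for every }\zeta\in\partial\Omega\text{ and every }\varepsilon>0\Big\}$$ is dense and $G_\delta$ in $\bigcap_{p<q}\mathcal{O}L^p(\Omega)$.
   Context: For a bounded open $\Omega\subset\mathbb C^n$ and $p\ge1$, $\mathcal{O}L^p(\Omega)$ is the Banach space of holomorphic $f$ on $\Omega$ with $\|f\|_p=(\int_\Omega|f|^p\,dv)^{1/p}<\infty$. For $q>1$, $\bigcap_{p<q}\mathcal{O}L^p(\Omega)$ carries the complete metric $d(f,g)=\sum_j2^{-j}\frac{\|f-g\|_{p_j}}{1+\|f-g\|_{p_j}}$ with $1<p_1<p_2<\dots$, $p_j\to q$; convergence means $\|f_k-f\|_p\to0$ for all $p<q$. *)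

(* Defs.v *)
From HB Require Import structures.
From mathcomp Require Import all_boot all_order all_algebra.
From mathcomp Require Import all_classical all_reals all_analysis.
From mathcomp.real_closed Require Import complex.
Set Implicit Arguments. Unset Strict Implicit. Unset Printing Implicit Defensive.
Import Order.TTheory GRing.Theory Num.Theory.
Import numFieldNormedType.Exports.
Local Open Scope classical_set_scope.
Local Open Scope ring_scope.

Section Defs.
Variable R : realType.
Local Notation C := (R[i]).

Definition pt (n : nat) := 'I_n -> C.

Definition cabs (x : C) : R := ComplexField.Normc.normc x.

Definition dist2 n (z w : pt n) : R := \sum_(i < n) cabs (z i - w i) ^+ 2.

Definition cball n (eta : pt n) (eps : R) : set (pt n) :=
  [set z | dist2 z eta < eps ^+ 2].

Definition c_open n (Om : set (pt n)) : Prop :=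
  forall z, Om z -> exists r : R, 0 < r /\ cball z r `<=` Om.

Definition c_bounded n (Om : set (pt n)) : Prop :=
  exists M : R, forall z, Om z -> dist2 z (fun _ => 0) <= M.

Definition c_closure n (Om : set (pt n)) : set (pt n) :=
  [set z | forall r : R, 0 < r -> exists w, Om w /\ dist2 w z < r ^+ 2].

Definition c_boundary n (Om : set (pt n)) : set (pt n) :=
  c_closure Om `\` Om.

Definition addpt n (z h : pt n) : pt n := fun i => z i + h i.

Definition holomorphic_on n (Om : set (pt n)) (f : pt n -> C) : Prop :=
  forall z, Om z -> exists a : 'I_n -> C,
    forall eps : R, 0 < eps -> exists delta : R, 0 < delta /\
      forall h : pt n, dist2 h (fun _ => 0) < delta ^+ 2 ->
        cabs (f (addpt z h) - f z - \sum_(i < n) a i * h i)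
          <= eps * Num.sqrt (dist2 h (fun _ => 0)).

(* Lebesgue integration on R^m, as iterated one-dimensional Lebesgue
   integrals (equal, by Tonelli, to the integral against Lebesgue measure
   on R^m for the nonnegative measurable integrands used below).  Points of
   R^m are sequences x : nat -> R, only the first m coordinates matter. *)
Definition scons (t : R) (x : nat -> R) : nat -> R :=
  fun k => if k is k'.+1 then x k' else t.

Fixpoint iint (m : nat) (F : (nat -> R) -> \bar R) : \bar R :=
  match m with
  | 0 => F (fun _ => 0)
  | m'.+1 => (\int[@lebesgue_measure R]_t iint m' (fun x => F (scons t x)))%E
  end.

Definition toC n (x : nat -> R) : pt n :=
  fun k => (x (2 * k)%N +i* x (2 * k + 1)%N)%C.

Definition vint n (g : pt n -> \bar R) : \bar R := iint (2 * n) (fun x => g (@toC n x)).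

Definition Lp_int n (A : set (pt n)) (p : R) (f : pt n -> C) : \bar R :=
  vint (fun z => (\1_A z * (cabs (f z) `^ p))%:E).

Definition OLcap n (Om : set (pt n)) (q : R) : set (pt n -> C) :=
  [set f | holomorphic_on Om f /\
     forall p : R, 1 <= p -> p < q -> (Lp_int Om p f < +oo)%E].

(* the L^p norm ||f||_p on Om (for f with finite integral) *)
Definition Lp_norm n (Om : set (pt n)) (p : R) (f : pt n -> C) : R :=
  (fine (Lp_int Om p f)) `^ p^-1.

Definition pseq (q : R) (j : nat) : R := q - (q - 1) / j.+1%:R.

Definition OLdist n (Om : set (pt n)) (q : R) (f g : pt n -> C) : R :=
  let t j := Lp_norm Om (pseq q j) (fun z => f z - g z) in
  limn (series (fun k => (2 ^- k.+1) * (t k.+1 / (1 + t k.+1)))).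

Definition Sset n (Om : set (pt n)) (q : R) : set (pt n -> C) :=
  [set g | OLcap Om q g /\
     forall zeta, c_boundary Om zeta -> forall eps : R, 0 < eps ->
       Lp_int (cball zeta eps `&` Om) q g = +oo%E].

Definition OL_dense n (Om : set (pt n)) (q : R) (S : set (pt n -> C)) : Prop :=
  S `<=` OLcap Om q /\
  forall f, OLcap Om q f -> forall e : R, 0 < e ->
    exists g, S g /\ OLdist Om q f g < e.

Definition OL_open n (Om : set (pt n)) (q : R) (U : set (pt n -> C)) : Prop :=
  forall f, OLcap Om q f -> U f -> exists r : R, 0 < r /\
    forall g, OLcap Om q g -> OLdist Om q f g < r -> U g.

Definition OL_Gdelta n (Om : set (pt n)) (q : R) (S : set (pt n -> C)) : Prop :=
  exists U : nat -> set (pt n -> C), (forall k, OL_open Om q (U k)) /\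
    S = [set f | OLcap Om q f /\ forall k, U k f].

End Defs.

(* Main.v *)
(**
The singular functions form a countable intersection of open sets: by Fatou
and [t^p <= 1 + t^q] on sets of finite volume, [int_A |g|^q] is infinite iff
the norms of [g] in [L^p(A)], [p < q], are unbounded, and the balls around
boundary points may be replaced by the rational boxes that meet the boundary.

Density is a Baire argument made explicit, so that completeness of the function
space is not needed. Adding to [g] a small multiple of a function that is
singular on a box makes the sum singular there, hence of norm greater than any
given level for some exponent [p < q]; later perturbations are kept so small in
that norm that the level survives. They are moreover uniformly small on the
members of an exhaustion of [Om] by compact sets, so that the sums converge
locally uniformly.

The limit is holomorphic by Weierstrass' theorem, which rests on a Cauchy
estimate for functions that are only assumed to be complex differentiable at
each point. For [G] of one variable, Goursat's bisection is applied to
[(G(e^w) - G(0)) e^(-w)] on the rectangle [[s1, s2] x [0, 2 pi]]: periodicity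
makes the mean over vertical segments independent of the abscissa, and it tends
to [G'(0)] at [-oo].
*)

(* Holomorphy means differentiability at each point, with no continuity of the derivative, so
   Green's theorem does not apply; hence the bisection. It is run on an abstract additive function
   of rectangles and uses only real and imaginary parts; a rotation then recovers the modulus, and
   complex lines reduce several variables to one.

   The integrals are iterated one-dimensional integrals, so integration theory does not apply to
   them directly. A sigma-finite measure space is built whose integrals agree with [Lp_int] for open
   sets and holomorphic functions, and the integral inequalities are proved there. Norms are
   extended reals, which lets largeness be stated before finiteness is known.

   The norms of the added singular function may blow up as [p] tends to [q], so one stage can
   control only finitely many exponents. This forces the bookkeeping of protected exponents. Each
   level is certified at a single exponent, which is then protected; and since the protected range
   grows strictly, every exponent is eventually controlled, which puts the limit into the space. *)
Require Import Defs.
From HB Require Import structures.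
From mathcomp Require Import all_boot all_order all_algebra.
From mathcomp Require Import all_classical all_reals all_analysis.
From mathcomp Require Import measurable_realfun zify ring lra.
From mathcomp.real_closed Require Import complex.
Set Implicit Arguments. Unset Strict Implicit. Unset Printing Implicit Defensive.
Import Order.TTheory GRing.Theory Num.Theory.
Import numFieldNormedType.Exports.
Local Open Scope classical_set_scope.
Local Open Scope ring_scope.

Local Notation re := (@complex.Re _).
Local Notation im := (@complex.Im _).

(** * Complex numbers and points of C^n *)

Section ComplexModulus.
Context {R : realType}.
Local Notation C := R[i].
Implicit Types x y : C.

Lemma cabsE x : cabs x = Num.sqrt (re x ^+ 2 + im x ^+ 2).
Proof. by case: x. Qed.

Lemma cabs_ge0 x : 0 <= cabs x.
Proof. by rewrite cabsE sqrtr_ge0. Qed.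

Lemma cabs0 : cabs (0 : C) = 0.
Proof. exact: ComplexField.Normc.normc0. Qed.

Lemma cabsM x y : cabs (x * y) = cabs x * cabs y.
Proof. exact: ComplexField.Normc.normcM. Qed.

Lemma cabsD x y : cabs (x + y) <= cabs x + cabs y.
Proof.
have /= := @ler_normD C C x y.
by rewrite lecE /= => /andP[_].
Qed.

Lemma cabsN x : cabs (- x) = cabs x.
Proof. by case: x => a b; rewrite !cabsE /= !sqrrN. Qed.

Lemma cabsBC x y : cabs (x - y) = cabs (y - x).
Proof. by rewrite -cabsN opprB. Qed.

Lemma cabsB x y : cabs (x - y) <= cabs x + cabs y.
Proof. by rewrite -(cabsN y) cabsD. Qed.

Lemma cabs_real (r : R) : cabs (r%:C)%C = `|r|.
Proof. by rewrite cabsE /= expr0n /= addr0 sqrtr_sqr. Qed.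

Lemma cabs1 : cabs (1 : C) = 1.
Proof. by rewrite -[1]/((1 : R)%:C)%C cabs_real normr1. Qed.

Lemma Re_le_cabs x : `|re x| <= cabs x.
Proof. by rewrite cabsE -sqrtr_sqr ler_wsqrtr // lerDl sqr_ge0. Qed.

Lemma Im_le_cabs x : `|im x| <= cabs x.
Proof. by rewrite cabsE -sqrtr_sqr ler_wsqrtr // lerDr sqr_ge0. Qed.

Lemma cabs_leD x : cabs x <= `|re x| + `|im x|.
Proof.
rewrite cabsE -[leRHS]ger0_norm ?addr_ge0 // -sqrtr_sqr ler_wsqrtr //.
rewrite sqrrD !real_normK ?num_real // -addrA lerD2l lerDr.
by rewrite mulrn_wge0 // mulr_ge0.
Qed.

Lemma cabs_eq0 x : cabs x = 0 -> x = 0.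
Proof. exact: ComplexField.Normc.eq0_normc. Qed.

Lemma cabs_sum (I : finType) (F : I -> C) :
  cabs (\sum_i F i) <= \sum_i cabs (F i).
Proof.
elim/big_ind2 : _ => [|a x b y ax byy|//]; first by rewrite cabs0.
exact: le_trans (cabsD _ _) (lerD _ _).
Qed.

(** Take the conjugate of [x] divided by its modulus. Mean values and the mean value theorem see
    only real functions; this rotation turns their bounds on real parts into bounds on the
    modulus. *)
Lemma Re_rotate x : exists w : C, cabs w = 1 /\ re (w * x) = cabs x.
Proof.
have [->|x0] := eqVneq x 0; first by exists 1; rewrite cabs1 mulr0 cabs0.
have nx0 : cabs x != 0 by apply: contra x0 => /eqP/cabs_eq0/eqP.
exists (((cabs x)^-1)%:C%C * (re x -i* im x)%C); split.
  rewrite cabsM cabs_real ger0_norm ?invr_ge0 ?cabs_ge0 // -[RHS](mulVf nx0).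
  by rewrite [X in _ * X = _]cabsE /= sqrrN -cabsE.
have E : re x ^+ 2 + im x ^+ 2 = cabs x ^+ 2.
  by rewrite cabsE sqr_sqrtr // addr_ge0 // sqr_ge0.
case: x {x0} nx0 E => a b /= nx0 E.
rewrite -[RHS](mulKf nx0) -expr2 -E; ring.
Qed.

End ComplexModulus.

Section Points.
Context {R : realType}.
Local Notation C := R[i].

Definition vabs {n} (h : pt R n) : R := Num.sqrt (dist2 h (fun=> 0)).

Definition scalept {n} (m : C) (h : pt R n) : pt R n := fun i => m * h i.

Variable n : nat.
Implicit Types (z w u h : pt R n) (r : R).

Lemma dist2_ge0 z w : 0 <= dist2 z w.
Proof. by apply: sumr_ge0 => i _; rewrite sqr_ge0. Qed.

Lemma dist2C z w : dist2 z w = dist2 w z.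
Proof. by apply: eq_bigr => i _; rewrite cabsBC. Qed.

Lemma dist2zz z : dist2 z z = 0.
Proof. by apply: big1 => i _; rewrite subrr cabs0 expr0n. Qed.

(* Without Cauchy-Schwarz; the factor 2 suffices since only half radii are
   ever added. *)
Lemma dist2_quasi_tri z w u : dist2 z u <= 2 * (dist2 z w + dist2 w u).
Proof.
rewrite -big_split mulr_sumr; apply: ler_sum => i _ /=.
have : cabs (z i - u i) <= cabs (z i - w i) + cabs (w i - u i).
  by rewrite (le_trans _ (cabsD _ _)) // addrA subrK.
have := cabs_ge0 (z i - u i).
set a := cabs (z i - u i); set b := cabs (z i - w i); set c := cabs (w i - u i).
move=> a0 abc.
have : 0 <= (b + c - a) * (b + c + a) by apply: mulr_ge0; lra.
have := sqr_ge0 (b - c); nra.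
Qed.

Lemma vabs_ge0 h : 0 <= vabs h.
Proof. exact: sqrtr_ge0. Qed.

Lemma vabs_sqr h : vabs h ^+ 2 = dist2 h (fun=> 0).
Proof. by rewrite sqr_sqrtr // dist2_ge0. Qed.

Lemma dist2_addpt z h : dist2 (addpt z h) z = vabs h ^+ 2.
Proof.
by rewrite vabs_sqr; apply: eq_bigr => i _; rewrite /addpt addrAC subrr add0r subr0.
Qed.

Lemma addpt_sub z w : addpt z (fun i => w i - z i) = w.
Proof. by apply/funext => i; rewrite /addpt addrC subrK. Qed.

Lemma vabs_lt h r : 0 < r -> (vabs h < r) = (dist2 h (fun=> 0) < r ^+ 2).
Proof.
move=> r0; rewrite -vabs_sqr ltr_pXn2r // nnegrE ?vabs_ge0 //; exact: ltW.
Qed.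

Lemma cball_addpt z h r : 0 < r -> cball z r (addpt z h) = (vabs h < r) :> Prop.
Proof. by move=> r0; rewrite /cball /= dist2_addpt vabs_sqr vabs_lt. Qed.

Lemma vabsZ (m : C) h : vabs (scalept m h) = cabs m * vabs h.
Proof.
rewrite /vabs /dist2 -[X in X * _]ger0_norm ?cabs_ge0 // -sqrtr_sqr -sqrtrM ?sqr_ge0 //.
congr (Num.sqrt _); rewrite mulr_sumr; apply: eq_bigr => i _.
by rewrite !subr0 cabsM exprMn.
Qed.

Lemma cabs_le_vabs h i : cabs (h i) <= vabs h.
Proof.
rewrite -[leLHS]ger0_norm ?cabs_ge0 // -sqrtr_sqr ler_wsqrtr //.
rewrite /dist2 (bigD1 i) //= subr0 lerDl.
by apply: sumr_ge0 => j _; exact: sqr_ge0.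
Qed.

Lemma coord_le h (M : R) i : dist2 h (fun=> 0) <= M -> cabs (h i) <= 1 + M.
Proof.
rewrite -vabs_sqr => hM; apply: le_trans (cabs_le_vabs h i) _.
by have := sqr_ge0 (vabs h - 1); nra.
Qed.

Lemma cball_center z r : 0 < r -> cball z r z.
Proof. by move=> r0; rewrite /cball /= dist2zz exprn_gt0. Qed.

Lemma cball_half z w r : 0 < r -> cball z (r / 2) w -> cball w (r / 2) `<=` cball z r.
Proof.
move=> r0 zw u wu; move: zw wu; rewrite /cball /= => zw wu.
apply: (le_lt_trans (dist2_quasi_tri u w z)).
by move: zw wu; rewrite expr_div_n; lra.
Qed.

Lemma sub_cball z r s : 0 <= r -> r <= s -> cball z r `<=` cball z s.
Proof.
move=> r0 rs w; rewrite /cball /= => /lt_le_trans; apply.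
by rewrite ler_pXn2r // nnegrE (le_trans r0).
Qed.

Lemma cabs_lin (a : 'I_n -> C) h :
  cabs (\sum_i a i * h i) <= (\sum_i cabs (a i)) * vabs h.
Proof.
rewrite (le_trans (cabs_sum _)) // mulr_suml; apply: ler_sum => i _.
by rewrite cabsM ler_wpM2l ?cabs_ge0 // cabs_le_vabs.
Qed.

End Points.

(** * Goursat's theorem *)

Section Goursat.
Context {R : realType}.

Definition rect_additive (phi : R -> R -> R -> R -> R) :=
  (forall a m b c d, phi a b c d = phi a m c d + phi m b c d) /\
  (forall a b c m d, phi a b c d = phi a b c m + phi a b m d).

(** By additivity the value is the sum over the four quarters, so they cannot all be at most [K / 4]
    in modulus. *)
Lemma rect_quarter phi a c l w K : rect_additive phi ->
  K < `|phi a (a + l) c (c + w)| ->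
  exists a' c', [/\ (a' = a \/ a' = a + l / 2), (c' = c \/ c' = c + w / 2) &
    K / 4 < `|phi a' (a' + l / 2) c' (c' + w / 2)|].
Proof.
move=> [addx addy] Kphi.
have lE : a + l / 2 + l / 2 = a + l by lra.
have wE : c + w / 2 + w / 2 = c + w by lra.
have E : phi a (a + l) c (c + w) =
  (phi a (a + l / 2) c (c + w / 2) + phi a (a + l / 2) (c + w / 2) (c + w)) +
  (phi (a + l / 2) (a + l) c (c + w / 2) + phi (a + l / 2) (a + l) (c + w / 2) (c + w)).
  by rewrite -!addy -addx.
apply: contrapT => H.
have A a' c' : (a' = a \/ a' = a + l / 2) -> (c' = c \/ c' = c + w / 2) ->
    `|phi a' (a' + l / 2) c' (c' + w / 2)| <= K / 4.
  by move=> ha hc; rewrite leNgt; apply/negP => h; apply: H; exists a', c'.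
have := A a c (or_introl erefl) (or_introl erefl).
have := A a (c + w / 2) (or_introl erefl) (or_intror erefl).
have := A (a + l / 2) c (or_intror erefl) (or_introl erefl).
have := A (a + l / 2) (c + w / 2) (or_intror erefl) (or_intror erefl).
rewrite lE wE.
have := ler_normD (phi a (a + l / 2) c (c + w / 2) + phi a (a + l / 2) (c + w / 2) (c + w))
  (phi (a + l / 2) (a + l) c (c + w / 2) + phi (a + l / 2) (a + l) (c + w / 2) (c + w)).
have := ler_normD (phi a (a + l / 2) c (c + w / 2)) (phi a (a + l / 2) (c + w / 2) (c + w)).
have := ler_normD (phi (a + l / 2) (a + l) c (c + w / 2))
   (phi (a + l / 2) (a + l) (c + w / 2) (c + w)).
move: Kphi; rewrite E; lra.
Qed.

(** The intervals [[u k, u k + l / 2 ^+ k]] are nested, each being a half of the one before; the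
    supremum of the left ends lies in all of them. *)
Lemma nested_limit (u : nat -> R) (l : R) : 0 <= l ->
  (forall k, u k.+1 = u k \/ u k.+1 = u k + l / 2 ^+ k.+1) ->
  exists x, forall k, u k <= x <= u k + l / 2 ^+ k.
Proof.
move=> l0 ustep.
have pos k : 0 <= l / 2 ^+ k by rewrite divr_ge0 ?exprn_ge0.
have half k : l / 2 ^+ k = l / 2 ^+ k.+1 + l / 2 ^+ k.+1.
  by rewrite exprS invfM; lra.
have up k : u k <= u k.+1 by case: (ustep k) => ->; rewrite ?lerDl.
have dn k : u k.+1 + l / 2 ^+ k.+1 <= u k + l / 2 ^+ k.
  have := pos k.+1; rewrite [in X in _ -> X](half k).
  by case: (ustep k) => ->; lra.
have ups k j : u k <= u (k + j)%N.
  by elim: j => [|j IH]; rewrite ?addn0 // addnS (le_trans IH).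
have dns k j : u (k + j)%N + l / 2 ^+ (k + j) <= u k + l / 2 ^+ k.
  by elim: j => [|j IH]; rewrite ?addn0 // addnS (le_trans _ IH).
have cross k j : u j <= u k + l / 2 ^+ k.
  have := ups j k; have := dns k j; rewrite addnC.
  by have := pos (j + k)%N; lra.
have hs : has_sup (range u).
  split; first by exists (u 0%N), 0%N.
  by exists (u 0%N + l / 2 ^+ 0) => _ [j _ <-]; exact: cross.
exists (sup (range u)) => k; apply/andP; split.
  by apply: sup_upper_bound => //; exists k.
by apply: ge_sup => //; [exists (u 0%N), 0%N|move=> _ [j _ <-]; exact: cross].
Qed.

(* Goursat's bisection; [phi a b c d] stands for a boundary integral over
   [[a, b] x [c, d]]. *)
Lemma rect_vanish phi a c l w : rect_additive phi ->
  0 <= l -> 0 <= w ->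
  (forall x y, a <= x <= a + l -> c <= y <= c + w ->
   forall e, 0 < e -> exists2 d, 0 < d &
     forall a' c' l' w', 0 <= l' -> 0 <= w' -> a <= a' -> a' + l' <= a + l ->
       c <= c' -> c' + w' <= c + w ->
       a' <= x <= a' + l' -> c' <= y <= c' + w' -> l' < d -> w' < d ->
       `|phi a' (a' + l') c' (c' + w')| <= e * (l' + w') ^+ 2) ->
  phi a (a + l) c (c + w) = 0.
Proof.
move=> addphi l0 w0 loc; apply: contrapT => /eqP phi0.
set N := `|phi a (a + l) c (c + w)|.
have N0 : 0 < N by rewrite normr_gt0.
pose L k := l / 2 ^+ k; pose W k := w / 2 ^+ k.
have L0 k : 0 <= L k by rewrite divr_ge0 ?exprn_ge0.
have W0 k : 0 <= W k by rewrite divr_ge0 ?exprn_ge0.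
have LS k : L k / 2 = L k.+1 by rewrite /L exprS invfM; lra.
have WS k : W k / 2 = W k.+1 by rewrite /W exprS invfM; lra.
(* Half of [N], because the inequality kept along the bisection is strict: for [k = 0] it reads
   [N / 2 < N]. *)
pose good k (p : R * R) := [/\ a <= p.1, p.1 + L k <= a + l,
  c <= p.2, p.2 + W k <= c + w &
  N / 2 / 4 ^+ k < `|phi p.1 (p.1 + L k) p.2 (p.2 + W k)|].
have step kp : exists p', good kp.1 kp.2 ->
  [/\ (p'.1 = kp.2.1 \/ p'.1 = kp.2.1 + L kp.1.+1),
      (p'.2 = kp.2.2 \/ p'.2 = kp.2.2 + W kp.1.+1) & good kp.1.+1 p'].
  case: kp => k p /=; have [gp|ngp] := pselect (good k p); last by exists p.
  case: gp => /= ap pa cp pc Np.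
  have Lk1 := L0 k.+1; have LSk := LS k; have Wk1 := W0 k.+1; have WSk := WS k.
  have [a' [c' [ha hc Np']]] := rect_quarter addphi Np.
  exists (a', c') => _ /=; rewrite -LS -WS; split => //; split => /=.
  - by case: ha => ->; lra.
  - by rewrite -LS; case: ha => ->; lra.
  - by case: hc => ->; lra.
  - by rewrite -WS; case: hc => ->; lra.
  by rewrite -LS -WS exprS invfM mulrCA mulrC.
have [f fP] := choice step.
pose s := fix s k := if k is k'.+1 then f (k', s k') else (a, c).
have gs k : good k (s k).
  elim: k => [|k IH]; last by have [] := fP (k, s k) IH.
  rewrite /good /= /L /W !expr0 !divr1; split => //.
  by rewrite -/N; lra.
have [x xP] : exists x, forall k, (s k).1 <= x <= (s k).1 + L k.
  by apply: nested_limit => // k; have [] := fP (k, s k) (gs k).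
have [y yP] : exists y, forall k, (s k).2 <= y <= (s k).2 + W k.
  by apply: nested_limit => // k; have [] := fP (k, s k) (gs k).
have xal : a <= x <= a + l by have := xP 0%N; rewrite /= /L expr0 divr1.
(* With this [e] the local estimate at depth [k] is at most [N / 2 / 4 ^+ k], against the lower
   bound in [good]. The summand 1 keeps the denominator positive for a degenerate rectangle. *)
pose e := N / 2 / ((l + w) ^+ 2 + 1).
have den0 : 0 < (l + w) ^+ 2 + 1 by rewrite ltr_wpDl ?sqr_ge0.
have e0 : 0 < e by rewrite /e !divr_gt0.
have ycw : c <= y <= c + w by have := yP 0%N; rewrite /= /W expr0 divr1.
have [d d0 dP] := loc x y xal ycw e e0.
have [k kP] : exists k, L k < d /\ W k < d.
  have [k hk] : exists k, (l + w) / d < 2 ^+ k.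
    exists (Num.bound ((l + w) / d)).
    apply: (lt_le_trans (archi_boundP _)); first by rewrite divr_ge0 // ?addr_ge0 // ltW.
    by rewrite -natrX ler_nat ltnW // ltn_expl.
  exists k; rewrite /L /W !ltr_pdivrMr ?exprn_gt0 //.
  move: hk; rewrite ltr_pdivrMr // mulrC; lra.
have [ga gb gc gd gN] := gs k.
have := dP (s k).1 (s k).2 (L k) (W k) (L0 k) (W0 k) ga gb gc gd (xP k) (yP k) kP.1 kP.2.
move/(lt_le_trans gN); rewrite /L /W -mulrDl expr_div_n -exprM mulnC exprM.
have -> : (2 : R) ^+ 2 = 4 by rewrite expr2; lra.
rewrite mulrA ltr_pM2r ?invr_gt0 ?exprn_gt0 // ltNge => /negP; apply.
by rewrite /e mulrAC ler_pdivrMr // ler_pM2l ?divr_gt0 // lerDl.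
Qed.

Lemma primitive_exists (h : R -> R) (A B : R) :
  (forall x, A <= x <= B -> {for x, continuous h}) ->
  exists H : R -> R, forall x, A < x < B -> is_derive x 1 H (h x).
Proof.
move=> ch; exists (fun x => \int[@lebesgue_measure R]_(t in `[A, x]) h t)%R => x /andP[Ax xB].
have intB : (@lebesgue_measure R).-integrable `[A, B] (EFin \o h).
  apply: continuous_compact_integrable; first exact: (@segment_compact R).
  by apply: continuous_in_subspaceT => y; rewrite inE /= in_itv /= => /ch.
have [] := @continuous_FTC1_closed R h A x B xB intB Ax.
  by apply: ch; rewrite !ltW.
by move=> dH <-; rewrite derive1E; exact: DeriveDef.
Qed.

(** A choice depending on [A], [B] and [h] alone: equal integrands have equal primitives, which is
    how periodicity enters [periodic_mean_le]. *)
Definition primitive (A B : R) (h : R -> R) : R -> R :=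
  get [set H | forall x, A < x < B -> is_derive x 1 H (h x)].

Lemma primitiveP A B (h : R -> R) :
  (forall x, A <= x <= B -> {for x, continuous h}) ->
  forall x, A < x < B -> is_derive x 1 (primitive A B h) (h x).
Proof. by move=> ch; exact: (getPex (primitive_exists ch)). Qed.

(** Subtracting the quadratic primitive of the affine function leaves a function whose derivative is
    at most [e] in modulus on [[a, b]]; the mean value theorem bounds its increment. *)
Lemma primitive_approx A B (h : R -> R) a b al be e :
  (forall x, A <= x <= B -> {for x, continuous h}) ->
  A < a -> a <= b -> b < B ->
  (forall x, a <= x <= b -> `|h x - (al + be * x)| <= e) ->
  `|primitive A B h b - primitive A B h a
    - (al * (b - a) + be * ((b ^+ 2 - a ^+ 2) / 2))| <= e * (b - a).
Proof.
move=> ch Aa ab bB happ; have HP := primitiveP ch.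
set H := primitive A B h.
pose F x := H x - (al * x + be / 2 * x ^+ 2).
have dF x : A < x < B -> is_derive x 1 F (h x - (al + be * x)).
  move=> xAB; have dHx := HP x xAB.
  apply: is_derive_eq.
  rewrite /GRing.scale /= !mulr1 ?mulr0 ?addr0 ?expr1; lra.
have [||x xab] := @MVT_segment R F (fun x => h x - (al + be * x)) a b ab.
- by move=> x; rewrite in_itv /= => /andP[ax xb]; apply: dF; lra.
- apply: continuous_in_subspaceT => x; rewrite inE /= in_itv /= => /andP[ax xb].
  apply/differentiable_continuous/derivable1_diffP.
  by have [] : is_derive x 1 F (h x - (al + be * x)) by apply: dF; lra.
rewrite /F => E.
have -> : H b - H a - (al * (b - a) + be * ((b ^+ 2 - a ^+ 2) / 2)) =
  (h x - (al + be * x)) * (b - a) by rewrite -E; lra.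
rewrite normrM [`|b - a|]ger0_norm ?subr_ge0 // ler_wpM2r ?subr_ge0 //.
by apply: happ; move: xab; rewrite in_itv.
Qed.

Lemma primitive_mean A B (h : R -> R) a b :
  (forall x, A <= x <= B -> {for x, continuous h}) -> A < a -> a <= b -> b < B ->
  exists2 x, a <= x <= b & primitive A B h b - primitive A B h a = h x * (b - a).
Proof.
move=> ch Aa ab bB; have dH := primitiveP ch.
have [||x xab E] := @MVT_segment R (primitive A B h) h a b ab.
- by move=> x; rewrite in_itv /= => /andP[ax xb]; apply: dH; lra.
- apply: continuous_in_subspaceT => x; rewrite inE /= in_itv /= => /andP[ax xb].
  apply/differentiable_continuous/derivable1_diffP.
  by have [] : is_derive x 1 (primitive A B h) (h x) by apply: dH; lra.
by exists x; move: xab; rewrite in_itv.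
Qed.

End Goursat.

(** * Conjugate pairs and the mean over a period *)

Section ConjugatePair.
Context {R : realType}.
Implicit Types (u v : R -> R -> R).

(* The Cauchy-Riemann equations for [u + i v] at [x + i y], in the sense of
   real differentiability. *)
Definition conj_diff u v x y := exists al be : R, forall e, 0 < e ->
  exists2 d, 0 < d & forall x' y', `|x' - x| < d -> `|y' - y| < d ->
   `|u x' y' - (u x y + al * (x' - x) - be * (y' - y))| <= e * (`|x' - x| + `|y' - y|) /\
   `|v x' y' - (v x y + be * (x' - x) + al * (y' - y))| <= e * (`|x' - x| + `|y' - y|).

Lemma lipschitz_at_continuous (h : R -> R) x L d : 0 < d ->
  (forall x', `|x' - x| < d -> `|h x' - h x| <= L * `|x' - x|) ->
  {for x, continuous h}.
Proof.
move=> d0 hL; apply/cvgrPdist_lt => e e0.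
have L0 : 0 < `|L| + 1 by rewrite ltr_wpDl.
apply/nbhs_ballP; exists (Num.min d (e / (`|L| + 1))) => /=.
  by rewrite lt_min d0 divr_gt0.
move=> t; rewrite /ball /= distrC lt_min => /andP[td tL].
rewrite distrC (le_lt_trans (hL t td)) //.
move: tL; rewrite ltr_pdivlMr //; have := ler_norm L; have := normr_ge0 (t - x); nra.
Qed.

Lemma conj_diff_continuous_v u v x y : conj_diff u v x y ->
  {for x, continuous (fun s => v s y)}.
Proof.
move=> [al [be uv]]; have [d d0 dP] := uv 1 ltr01.
apply: (@lipschitz_at_continuous _ _ (`|be| + 1) d) => // x' x'd.
have [||_] := dP x' y => //; first by rewrite subrr normr0.
rewrite subrr normr0 mulr0 !addr0 mul1r => h.
have -> : v x' y - v x y = (v x' y - (v x y + be * (x' - x))) + be * (x' - x) by ring.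
rewrite (le_trans (ler_normD _ _)) // normrM; lra.
Qed.

Lemma conj_diff_continuous_u u v x y : conj_diff u v x y ->
  {for y, continuous (u x)}.
Proof.
move=> [al [be uv]]; have [d d0 dP] := uv 1 ltr01.
apply: (@lipschitz_at_continuous _ _ (`|be| + 1) d) => // y' y'd.
have [||+ _] := dP x y' => //; first by rewrite subrr normr0.
rewrite subrr normr0 mulr0 addr0 add0r mul1r => h.
have -> : u x y' - u x y = (u x y' - (u x y - be * (y' - y))) - be * (y' - y) by ring.
rewrite (le_trans (ler_normB _ _)) // normrM; lra.
Qed.

(* Integral form of the maximum principle on an annulus in logarithmic
   coordinates: the mean of [u] over a period does not depend on [s]. *)
Lemma periodic_mean_le u v (S T a b A B : R) : 0 < T -> a < b -> b < S ->
  (forall s t, s < S -> conj_diff u v s t) ->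
  (forall s, v s 0 = v s T) ->
  (forall t, 0 <= t <= T -> A <= u a t) ->
  (forall t, 0 <= t <= T -> u b t <= B) -> A <= B.
Proof.
move=> T0 ab bS uv vT uA uB.
(* Primitives are controlled only in the interior of their interval, and [v] only for abscissas
   below [S]; so the interval must end strictly between [b] and [S]. The margins of 1 at the other
   ends serve the same purpose. *)
pose S' := (b + S) / 2.
have cu s : s < S -> forall x, - 1 <= x <= T + 1 -> {for x, continuous (u s)}.
  by move=> sS x _; apply: conj_diff_continuous_u; exact: uv.
have cv t : forall x, a - 1 <= x <= S' -> {for x, continuous (fun s => v s t)}.
  move=> x xS'; apply: (conj_diff_continuous_v (uv _ _ _)).
  by move: xS'; rewrite /S'; lra.
pose V t := primitive (a - 1) S' (fun s => v s t).
pose U s := primitive (- 1) (T + 1) (u s).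
(* The imaginary part of the integral of [(u + i v) (ds + i dt)], that is of [v ds + u dt],
   counterclockwise: bottom, right, top, left. *)
pose phi s1 s2 t1 t2 := (V t1 s2 - V t1 s1) + (U s2 t2 - U s2 t1)
   - (V t2 s2 - V t2 s1) - (U s1 t2 - U s1 t1).
have phi0 : phi a (a + (b - a)) 0 (0 + T) = 0.
  apply: rect_vanish; [by split=> *; rewrite /phi; ring|lra|lra|].
  move=> x y xab yT e e0; have xS : x < S by lra.
  have [al [be alP]] := uv x y xS.
  (* The errors on the four sides add up to [e / 2 * (l + w) ^+ 2]. The affine parts cancel around
     the rectangle, which is the Cauchy-Riemann equations at work. *)
  have e4 : 0 < e / 4 by lra.
  have [d d0 dP] := alP _ e4; exists d => // a' c' l w l0 w0 aa' a'l cc' c'w xa' yc' ld wd.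
  have loc s t : a' <= s <= a' + l -> c' <= t <= c' + w ->
      `|u s t - (u x y + al * (s - x) - be * (t - y))| <= e / 4 * (l + w) /\
      `|v s t - (v x y + be * (s - x) + al * (t - y))| <= e / 4 * (l + w).
    move=> sa tc.
    have sx : `|s - x| <= l by rewrite ler_norml; lra.
    have ty : `|t - y| <= w by rewrite ler_norml; lra.
    have [hu hv] := dP s t (le_lt_trans sx ld) (le_lt_trans ty wd).
    have le : e / 4 * (`|s - x| + `|t - y|) <= e / 4 * (l + w).
      by apply: ler_wpM2l; [exact: ltW|exact: lerD].
    by split; [exact: le_trans hu le|exact: le_trans hv le].
  have estV t : c' <= t <= c' + w ->
      `|V t (a' + l) - V t a' - ((v x y - be * x + al * (t - y)) * (a' + l - a') +
         be * (((a' + l) ^+ 2 - a' ^+ 2) / 2))| <= e / 4 * (l + w) * (a' + l - a').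
    move=> tc; apply: primitive_approx; rewrite ?/S'; [exact: cv|lra|lra|lra|].
    move=> s sa; have [_] := loc s t sa tc.
    by congr (_ <= _); congr (`|_|); ring.
  have estU s : a' <= s <= a' + l ->
      `|U s (c' + w) - U s c' - ((u x y + al * (s - x) + be * y) * (c' + w - c') +
         (- be) * (((c' + w) ^+ 2 - c' ^+ 2) / 2))| <= e / 4 * (l + w) * (c' + w - c').
    move=> sa; apply: primitive_approx; [by apply: cu; lra|lra|lra|lra|].
    move=> t tc; have [+ _] := loc s t sa tc.
    by congr (_ <= _); congr (`|_|); ring.
  have := estV c'; have := estV (c' + w); have := estU a'; have := estU (a' + l).
  have i1 : a' <= a' + l <= a' + l by rewrite lexx lerDl l0.
  have i2 : a' <= a' <= a' + l by rewrite lexx lerDl.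
  have i3 : c' <= c' + w <= c' + w by rewrite lexx lerDl w0.
  have i4 : c' <= c' <= c' + w by rewrite lexx lerDl.
  move=> /(_ i1) + /(_ i2) + /(_ i3) + /(_ i4).
  have E0 : 0 <= e * (l + w) ^+ 2 by rewrite mulr_ge0 ?sqr_ge0 // ltW.
  rewrite !ler_norml /phi; clear -E0 => /andP[? ?] /andP[? ?] /andP[? ?] /andP[? ?].
  by apply/andP; split; lra.
have mean s : s < S -> exists2 t, 0 <= t <= T & U s T - U s 0 = u s t * T.
  move=> sS; have m1 : - 1 < 0 :> R by lra.
  have TT : T < T + 1 by lra.
  have [t tT E] := primitive_mean (cu s sS) m1 (ltW T0) TT.
  by exists t => //; rewrite -[T in RHS]subr0.
have aS := lt_trans ab bS.
have [t1 /uA hA E1] := mean a aS; have [t2 /uB hB E2] := mean b bS.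
move: phi0; rewrite /phi add0r (addrC a) subrK.
(* Bottom and top now cancel, so the integrals of [u] over the two vertical sides agree; [mean] has
   turned them into values of [u] to which the bounds [A] and [B] apply. *)
have -> : V T = V 0 by rewrite /V; congr primitive; apply/funext => s; rewrite vT.
have hA' : A * T <= u a t1 * T by rewrite ler_pM2r.
have hB' : u b t2 * T <= B * T by rewrite ler_pM2r.
by rewrite E1 E2 => E; rewrite -(ler_pM2r T0); lra.
Qed.

End ConjugatePair.

(** * The Cauchy estimate *)

Section ComplexDerivative.
Context {R : realType}.
Local Notation C := R[i].
Implicit Types (F G : C -> C) (w h a b : C).

Definition cdiff F w a := forall e : R, 0 < e -> exists2 d : R, 0 < d &
  forall h, cabs h < d -> cabs (F (w + h) - F w - a * h) <= e * cabs h.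

Lemma cdiff_lipschitz F w a : cdiff F w a -> exists2 d : R, 0 < d &
  forall h, cabs h < d -> cabs (F (w + h) - F w) <= (cabs a + 1) * cabs h.
Proof.
move=> /(_ 1 ltr01)[d d0 dP]; exists d => // h hd.
rewrite -(subrK (a * h) (F (w + h) - F w)) (le_trans (cabsD _ _)) // cabsM.
by have := dP h hd; lra.
Qed.

Lemma cdiffM F G w a b : cdiff F w a -> cdiff G w b ->
  cdiff (fun z => F z * G z) w (a * G w + F w * b).
Proof.
move=> dF dG e e0.
pose M := cabs (F w) + cabs (G w) + cabs a + cabs b + 1 + cabs a * cabs b.
have a0 := cabs_ge0 a; have b0 := cabs_ge0 b.
have M0 : 0 < M.
  rewrite /M; have := cabs_ge0 (F w); have := cabs_ge0 (G w).
  by have := mulr_ge0 a0 b0; lra.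
have eM : 0 < e / M by rewrite divr_gt0.
have [d1 d10 d1P] := dF _ eM; have [d2 d20 d2P] := dG _ eM.
have [d3 d30 d3P] := cdiff_lipschitz dG.
exists (Num.min (Num.min d1 d2) (Num.min d3 (Num.min 1 (e / M)))).
  by rewrite !lt_min d10 d20 d30 ltr01 eM.
move=> h; rewrite !lt_min => /andP[/andP[/d1P h1 /d2P h2] /and3P[/d3P h3 h4 h5]].
set r := F (w + h) - F w - a * h in h1; set s := G (w + h) - G w - b * h in h2.
have -> : F (w + h) * G (w + h) - F w * G w - (a * G w + F w * b) * h =
  r * G (w + h) + ((F w + a * h) * s + a * b * (h * h)) by rewrite /r /s; ring.
rewrite (le_trans (cabsD _ _)) // (le_trans (lerD (lexx _) (cabsD _ _))) // !cabsM.
have hG : cabs (G (w + h)) <= cabs (G w) + cabs b + 1.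
  rewrite -(subrK (G w) (G (w + h))) (le_trans (cabsD _ _)) //.
  have := cabs_ge0 b; have := cabs_ge0 h; nra.
have hF : cabs (F w + a * h) <= cabs (F w) + cabs a.
  by rewrite (le_trans (cabsD _ _)) // cabsM lerD2l ler_piMr // ltW.
have E : e * cabs h = e / M * cabs h * M by rewrite mulrAC mulrVK // unitfE gt_eqF.
rewrite E; set k := e / M * cabs h in h1 h2 *.
have k0 : 0 <= k by rewrite mulr_ge0 ?cabs_ge0 // ltW.
have t1 : cabs r * cabs (G (w + h)) <= k * (cabs (G w) + cabs b + 1).
  by rewrite ler_pM ?cabs_ge0.
have t2 : cabs (F w + a * h) * cabs s <= (cabs (F w) + cabs a) * k.
  by rewrite ler_pM ?cabs_ge0.
have t3 : cabs a * cabs b * (cabs h * cabs h) <= cabs a * cabs b * k.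
  rewrite ler_wpM2l ?mulr_ge0 ?cabs_ge0 // /k ler_wpM2r ?cabs_ge0 //; exact: ltW.
rewrite /M; lra.
Qed.

Lemma cdiff_comp F G w a b : cdiff G w b -> cdiff F (G w) a ->
  cdiff (fun z => F (G z)) w (a * b).
Proof.
move=> dG dF e e0.
pose M := cabs a + cabs b + 1.
have M0 : 0 < M by rewrite /M; have := cabs_ge0 a; have := cabs_ge0 b; lra.
have eM : 0 < e / M by rewrite divr_gt0.
have b10 : 0 < cabs b + 1 by rewrite ltr_wpDl ?cabs_ge0.
have [d1 d10 d1P] := dF _ eM; have [d2 d20 d2P] := dG _ eM.
have [d3 d30 d3P] := cdiff_lipschitz dG.
exists (Num.min d2 (Num.min d3 (d1 / (cabs b + 1)))).
  by rewrite !lt_min d20 d30 divr_gt0.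
move=> h; rewrite !lt_min ltr_pdivlMr // => /and3P[/d2P h2 /d3P h3 h1].
set k := G (w + h) - G w in h3; set s := k - b * h in h2.
have kd : cabs k < d1 by rewrite (le_lt_trans h3) // mulrC.
have := d1P k kd; rewrite {1}/k [G w + _]addrC subrK => hk.
have -> : F (G (w + h)) - F (G w) - a * b * h =
  (F (G (w + h)) - F (G w) - a * k) + a * s by rewrite /s; ring.
rewrite (le_trans (cabsD _ _)) // cabsM.
have E : e * cabs h = e / M * cabs h * M by rewrite mulrAC mulrVK // unitfE gt_eqF.
rewrite E; have h0 := cabs_ge0 h; have a0 := cabs_ge0 a.
have t1 : e / M * cabs k <= e / M * ((cabs b + 1) * cabs h) by rewrite ler_wpM2l // ltW.
have t2 : cabs a * cabs s <= cabs a * (e / M * cabs h) by rewrite ler_wpM2l.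
rewrite {2}/M; lra.
Qed.

Lemma cdiff_cst (c w : C) : cdiff (fun=> c) w 0.
Proof. by move=> e e0; exists 1 => // h _; rewrite subrr mul0r subrr cabs0 mulr_ge0 ?cabs_ge0 ?ltW. Qed.

Lemma cdiffB F w a c : cdiff F w a -> cdiff (fun z => F z - c) w a.
Proof.
move=> dF e /dF[d d0 dP]; exists d => // h /dP.
by have -> : F (w + h) - c - (F w - c) - a * h = F (w + h) - F w - a * h by ring.
Qed.

Lemma cdiff_opp w : cdiff (fun z => - z) w (- 1).
Proof.
move=> e e0; exists 1 => // h _.
have -> : - (w + h) - - w - -1 * h = 0 by ring.
by rewrite cabs0 mulr_ge0 ?cabs_ge0 ?ltW.
Qed.

Lemma derive_approx (f : R -> R) (x df : R) : is_derive x 1 f df ->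
  forall e : R, 0 < e -> exists2 d : R, 0 < d &
    forall h : R, `|h| < d -> `|f (x + h) - f x - df * h| <= e * `|h|.
Proof.
move=> [dfx dfE] e e0; move: dfx; rewrite /derivable => /cvg_ex[l lP].
have lE : l = df by rewrite -dfE; apply/esym/cvg_lim.
move: lP => /cvgrPdist_le /(_ e e0); rewrite lE => /nbhs_ballP[d /= d0 dP].
exists d => // h hd; have [->|h0] := eqVneq h 0.
  by rewrite addr0 subrr mulr0 subrr normr0 mulr0.
have := dP h; rewrite /ball /= sub0r normrN => /(_ hd h0).
rewrite /GRing.scale /= mulr1 (addrC h) => k.
have -> : f (x + h) - f x - df * h = - (df - h^-1 * (f (x + h) - f x)) * h by field.
by rewrite normrM normrN ler_wpM2r.
Qed.

Lemma approx_derive (f : R -> R) (x df : R) :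
  (forall e : R, 0 < e -> exists2 d : R, 0 < d &
    forall h : R, `|h| < d -> `|f (x + h) - f x - df * h| <= e * `|h|) ->
  is_derive x 1 f df.
Proof.
move=> fx.
have lP : h^-1 *: (f (h *: (1 : R) + x) - f x) @[h --> 0^'] --> df.
  apply/cvgrPdist_le => e /fx[d d0 dP]; apply/nbhs_ballP; exists d => // h.
  rewrite /ball /= sub0r normrN => /dP H h0.
  rewrite /GRing.scale /= mulr1 (addrC h) -(ler_pM2r (_ : 0 < `|h|)) ?normr_gt0 //.
  apply: le_trans H; rewrite -normrM -normrN le_eqVlt; apply/orP; left.
  by apply/eqP; congr (`|_|); field.
apply: DeriveDef; first by apply/cvg_ex; exists df.
exact/cvg_lim.
Qed.

Definition expc (w : C) : C := (expR (re w) * cos (im w) +i* (expR (re w) * sin (im w)))%C.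

Lemma expcD w h : expc (w + h) = expc w * expc h.
Proof.
case: w h => [x y] [p q]; rewrite /expc /= expRD cosD sinD.
by apply/eqP; rewrite eq_complex /=; apply/andP; split; apply/eqP; ring.
Qed.

Lemma expc0 : expc 0 = 1.
Proof. by rewrite /expc /= expR0 cos0 sin0 mulr1 mulr0. Qed.

Lemma cabs_expc w : cabs (expc w) = expR (re w).
Proof.
by rewrite cabsE /= !exprMn -mulrDr cos2Dsin2 mulr1 sqrtr_sqr ger0_norm ?expR_ge0.

Qed.

Lemma expcK w : expc w * expc (- w) = 1.
Proof. by rewrite -expcD subrr expc0. Qed.

(** The functional equation moves the claim to the origin, where it follows from the first-order
    expansions of the real functions [expR], [sin] and [cos]. *)
Lemma cdiff_expc w : cdiff expc w (expc w).
Proof.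
suff d0 : cdiff expc 0 1.
  move=> e e0; have W0 : 0 < expR (re w) := expR_gt0 _.
  have [d dp dP] := d0 _ (divr_gt0 e0 W0); exists d => // h /dP.
  rewrite add0r expc0 mul1r expcD => H.
  have -> : expc w * expc h - expc w - expc w * h = expc w * (expc h - 1 - h) by ring.
  by rewrite cabsM cabs_expc mulrC -ler_pdivlMr // mulrAC.
(* The error is at most [3 * (k * cabs h)] in the real part and [4 * (k * cabs h)] in the imaginary
   part, hence the 8. The radius [k / 2] below keeps [expR x] at most 2. *)
move=> e e0; pose k := Num.min 1 (e / 8).
have k0 : 0 < k by rewrite lt_min ltr01 divr_gt0.
have k1 : k <= 1 by rewrite /k ge_min lexx.
have ke : k <= e / 8 by rewrite /k ge_min lexx orbT.
have [d1 d10 d1P] := derive_approx (is_derive_expR (0 : R)) k0.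
have [d2 d20 d2P] := derive_approx (is_derive_sin (0 : R)) k0.
have [d3 d30 d3P] := derive_approx (is_derive_cos (0 : R)) k0.
exists (Num.min (Num.min d1 d2) (Num.min d3 (k / 2))).
  by rewrite !lt_min d10 d20 d30 divr_gt0.
move=> [x y]; set h := (x +i* y)%C => hd.
have xh : `|x| <= cabs h := Re_le_cabs h.
have yh : `|y| <= cabs h := Im_le_cabs h.
move: hd; rewrite !lt_min => /andP[/andP[h1 h2] /andP[h3 h4]].
have := d1P x (le_lt_trans xh h1); rewrite add0r expR0 mul1r => ex.
have := d2P y (le_lt_trans yh h2); rewrite add0r sin0 cos0 subr0 mul1r => sy.
have := d3P y (le_lt_trans yh h3); rewrite add0r cos0 sin0 oppr0 mul0r subr0 => cy.
rewrite add0r expc0 mul1r (le_trans (cabs_leD _)) //= subr0.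
have E1 : expR x * cos y - 1 - x = expR x * (cos y - 1) + (expR x - 1 - x) by ring.
have E2 : expR x * sin y - y = expR x * (sin y - y) + (expR x - 1 - x) * y + x * y by ring.
have H0 := cabs_ge0 h.
have ex2 : `|expR x| <= 2.
  have -> : expR x = (expR x - 1 - x) + x + 1 by ring.
  rewrite (le_trans (ler_normD _ _)) // (le_trans (lerD (ler_normD _ _) (lexx _))) // normr1.
  have : k * `|x| <= 1 * cabs h by rewrite ler_pM // ltW.
  lra.
have kx : k * `|x| <= k * cabs h by rewrite ler_wpM2l // ltW.
have ky : k * `|y| <= k * cabs h by rewrite ler_wpM2l // ltW.
have A1 : `|expR x * cos y - 1 - x| <= 3 * (k * cabs h).
  rewrite E1 (le_trans (ler_normD _ _)) // normrM.
  have : `|expR x| * `|cos y - 1| <= 2 * (k * cabs h).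
    by rewrite ler_pM // (le_trans cy).
  lra.
have y1 : `|y| <= 1 by lra.
have A2 : `|expR x * sin y - y| <= 4 * (k * cabs h).
  rewrite E2 (le_trans (ler_normD _ _)) // (le_trans (lerD (ler_normD _ _) (lexx _))) // !normrM.
  have : `|expR x| * `|sin y - y| <= 2 * (k * cabs h).
    by rewrite ler_pM // (le_trans sy).
  have : `|expR x - 1 - x| * `|y| <= k * cabs h * 1.
    by rewrite ler_pM // (le_trans ex).
  have : `|x| * `|y| <= cabs h * k by rewrite ler_pM //; lra.
  lra.
have keh : k * cabs h <= e / 8 * cabs h by rewrite ler_wpM2r.
have eh0 : 0 <= e * cabs h by rewrite mulr_ge0 // ltW.
rewrite -[leRHS]/(e * cabs h); lra.
Qed.

Lemma cdiff_conj_diff F x y a : cdiff F (x +i* y)%C a ->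
  conj_diff (fun s t => re (F (s +i* t)%C)) (fun s t => im (F (s +i* t)%C)) x y.
Proof.
move=> dF; exists (re a), (im a) => e e0; have [d d0 dP] := dF e e0; exists (d / 2); first by lra.
move=> x' y' hx hy; pose h : C := ((x' - x) +i* (y' - y))%C.
have hle : cabs h <= `|x' - x| + `|y' - y| := cabs_leD h.
have hd : cabs h < d by lra.
have := dP h hd.
have -> : (x +i* y)%C + h = (x' +i* y')%C by rewrite /h /=; congr (_ +i* _)%C; ring.
move=> hF.
have eh : e * cabs h <= e * (`|x' - x| + `|y' - y|).
  by apply: ler_wpM2l; [exact: ltW|exact: hle].
split.
- apply: le_trans (le_trans hF eh); apply: le_trans (Re_le_cabs _).
  rewrite le_eqVlt; apply/orP; left; apply/eqP; congr (`|_|).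
  by case: (F _) (F _) a {dF dP hF} => ? ? [? ?] [? ?] /=; ring.
- apply: le_trans (le_trans hF eh); apply: le_trans (Im_le_cabs _).
  rewrite le_eqVlt; apply/orP; left; apply/eqP; congr (`|_|).
  by case: (F _) (F _) a {dF dP hF} => ? ? [? ?] [? ?] /=; ring.
Qed.

(* With [lam = e^w], the quotient [(G lam - G 0) / lam] is a 2 pi i-periodic
   holomorphic function of [w] that tends to [G' 0] as [re w] tends to -oo. *)
Lemma cauchy_bound G (r M : R) a : 0 < r ->
  (forall w, cabs w < r -> exists b, cdiff G w b) -> cdiff G 0 a ->
  (forall w, cabs w < r -> cabs (G w) <= M) -> cabs a <= 4 * M / r.
Proof.
move=> r0 dG dG0 GM; have [om [om1 omE]] := Re_rotate a.
pose F w := om * ((G (expc w) - G 0) * expc (- w)).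
apply/ler_addgt0Pr => e e0; rewrite -lerBlDr.
have [d d0 dP] := dG0 _ e0.
(* The outer circle has radius [r / 2], where the quotient is at most [2 * M / (r / 2)]; this is the
   origin of the 4. The inner radius [m] is below [d], so that the quotient there is within [e] of
   [a], and below [r / 2]. *)
pose b := ln (r / 2); pose m := Num.min (d / 2) (r / 4).
have m0 : 0 < m by rewrite lt_min !divr_gt0.
have md : m < d by rewrite /m gt_min ltr_pdivrMr // ltr_pMr // ltr1n.
have mr : m < r / 2 by rewrite /m gt_min; apply/orP; right; lra.
have eb : expR b = r / 2 by rewrite lnK // posrE divr_gt0.
have em : expR (ln m) = m by rewrite lnK.
apply: (@periodic_mean_le R (fun s t => re (F (s +i* t)%C)) (fun s t => im (F (s +i* t)%C))
  (ln r) (2 * pi) (ln m) b).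
- by rewrite mulr_gt0 // pi_gt0.
- by rewrite ltr_ln ?posrE // divr_gt0.
- by rewrite ltr_ln ?posrE ?divr_gt0 //; lra.
- move=> s t sr.
  have [c cP] : exists c, cdiff G (expc (s +i* t)%C) c.
    by apply: dG; rewrite cabs_expc /= -(lnK r0) ltr_expR.
  apply: cdiff_conj_diff; apply: cdiffM; first exact: cdiff_cst.
  apply: cdiffM.
    by apply: cdiffB; apply: cdiff_comp cP; exact: cdiff_expc.
  by apply: (cdiff_comp (cdiff_opp _)); exact: cdiff_expc.
- move=> s; rewrite /F /expc /= oppr0 !cosN !sinN cos0 sin0.
  by rewrite mulr_natl cos2pi sin2pi oppr0.
- move=> t _; set w := (_ +i* _)%C.
  have := dP (expc w); rewrite cabs_expc /= em add0r => /(_ md) H.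
  have : cabs (F w - om * a) <= e.
    have -> : F w - om * a = om * ((G (expc w) - G 0 - a * expc w) * expc (- w)).
      by rewrite /F -[in LHS](mulr1 a) -(expcK w); ring.
    rewrite cabsM om1 mul1r cabsM cabs_expc /= expRN em.
    by rewrite ler_pdivrMr.
  move=> /(le_trans (Re_le_cabs _)); rewrite ler_norml => /andP[+ _].
  have -> : re (F w - om * a) = re (F w) - re (om * a) by case: (F w) (om * a) => ? ? [].
  rewrite omE; lra.
- move=> t _; set w := (_ +i* _)%C.
  apply: (le_trans (ler_norm _)); apply: (le_trans (Re_le_cabs _)).
  rewrite !cabsM om1 mul1r cabs_expc /= expRN eb.
  have : cabs (G (expc w) - G 0) <= M + M.
    rewrite (le_trans (cabsB _ _)) // lerD //; apply: GM.
      by rewrite cabs_expc /= eb; lra.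
    by rewrite cabs0.
  move=> H; rewrite ler_pdivrMr ?divr_gt0 //.
  have -> : 4 * M / r * (r / 2) = M + M by field; lra.
  by [].
Qed.

End ComplexDerivative.

(** * Holomorphic functions of several variables *)

Section SeveralVariables.
Context {R : realType} {n : nat}.
Local Notation C := R[i].
Implicit Types (f g : pt R n -> C) (z w h : pt R n) (a b : 'I_n -> C) (Om : set (pt R n)).

(** The matrix of [holomorphic_on] for a given coefficient vector; the two are convertible, and
    proofs pass freely between them. *)
Definition fdiff f z a := forall eps : R, 0 < eps -> exists delta : R, 0 < delta /\
  forall h, dist2 h (fun=> 0) < delta ^+ 2 ->
    cabs (f (addpt z h) - f z - \sum_(i < n) a i * h i) <= eps * vabs h.

Lemma fdiff_continuous f z a : fdiff f z a -> forall e : R, 0 < e -> exists d : R,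
  0 < d /\ forall w, cball z d w -> cabs (f w - f z) < e.
Proof.
move=> fz e e0; have [d [d0 dP]] := fz 1 ltr01.
pose M := 1 + \sum_i cabs (a i).
have M0 : 0 < M by rewrite ltr_pwDl // sumr_ge0 // => i _; exact: cabs_ge0.
pose r := Num.min d (e / M).
have r0 : 0 < r by rewrite lt_min d0 divr_gt0.
exists r; split => // w; rewrite -(addpt_sub z w); set h := (fun i => w i - z i).
rewrite cball_addpt // lt_min => /andP[hd hM].
have := dP h; rewrite -vabs_lt // => /(_ hd) H.
rewrite -(subrK (\sum_(i < n) a i * h i) (f (addpt z h) - f z)).
rewrite (le_lt_trans (cabsD _ _)) // (le_lt_trans (lerD H (cabs_lin _ _))) //.
by rewrite -mulrDl mulrC -ltr_pdivlMr.
Qed.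

Lemma fdiff_sub f g z a b : fdiff f z a -> fdiff g z b ->
  fdiff (fun w => f w - g w) z (fun i => a i - b i).
Proof.
move=> df dg e e0; have e2 : 0 < e / 2 by lra.
have [d1 [d10 d1P]] := df _ e2; have [d2 [d20 d2P]] := dg _ e2.
have m0 : 0 < Num.min d1 d2 by rewrite lt_min d10.
exists (Num.min d1 d2); split => // h; rewrite -vabs_lt // lt_min => /andP[h1 h2].
have := d1P h; rewrite -vabs_lt // => /(_ h1) H1.
have := d2P h; rewrite -vabs_lt // => /(_ h2) H2.
have -> : \sum_(i < n) (a i - b i) * h i =
    \sum_(i < n) a i * h i - \sum_(i < n) b i * h i.
  by rewrite -sumrB; apply: eq_bigr => i _; rewrite mulrBl.
set sa := \sum_(i < n) a i * h i in H1 *; set sb := \sum_(i < n) b i * h i in H2 *.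
have -> : f (addpt z h) - g (addpt z h) - (f z - g z) - (sa - sb) =
  (f (addpt z h) - f z - sa) - (g (addpt z h) - g z - sb) by ring.
rewrite (le_trans (cabsB _ _)) //; lra.
Qed.

Lemma fdiffZ f z a (c : C) : fdiff f z a -> fdiff (fun w => c * f w) z (fun i => c * a i).
Proof.
move=> df e e0; have c0 : 0 < cabs c + 1 by rewrite ltr_wpDl ?cabs_ge0.
have [d [d0 dP]] := df _ (divr_gt0 e0 c0); exists d; split => // h /dP H.
have -> : \sum_(i < n) c * a i * h i = c * \sum_(i < n) a i * h i.
  by rewrite mulr_sumr; apply: eq_bigr => i _; rewrite mulrA.
rewrite -!mulrBr cabsM (le_trans (ler_wpM2l (cabs_ge0 c) H)) //.
rewrite mulrA ler_wpM2r ?vabs_ge0 // mulrCA -[leRHS]mulr1 ler_wpM2l ?ltW //.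
by rewrite ltr_pdivrMr // mul1r ltrDl.
Qed.

Lemma fdiff_line f z h (lam : C) a : fdiff f (addpt z (scalept lam h)) a ->
  cdiff (fun m => f (addpt z (scalept m h))) lam (\sum_(i < n) a i * h i).
Proof.
move=> df e e0; have h10 : 0 < vabs h + 1 by rewrite ltr_wpDl ?vabs_ge0.
have [d [d0 dP]] := df _ (divr_gt0 e0 h10).
exists (d / (vabs h + 1)); first by rewrite divr_gt0.
move=> m; rewrite ltr_pdivlMr // => hm.
have := dP (scalept m h); rewrite -vabs_lt // vabsZ.
have m0 := cabs_ge0 m; have h0 := vabs_ge0 h.
have hd : cabs m * vabs h < d by lra.
move=> /(_ hd).
have -> : addpt (addpt z (scalept lam h)) (scalept m h) = addpt z (scalept (lam + m) h).
  by apply/funext => i; rewrite /addpt /scalept mulrDl addrA.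
have -> : \sum_(i < n) a i * scalept m h i = (\sum_(i < n) a i * h i) * m.
  by rewrite mulr_suml; apply: eq_bigr => i _; rewrite /scalept; ring.
move=> /le_trans; apply.
rewrite mulrCA mulrC ler_wpM2r // mulrAC ler_pdivrMr // ler_pM2l //; lra.
Qed.

(** [cauchy_bound] on the complex line through [z] in the direction [h], which stays in the ball for
    parameters of modulus below [r / vabs h]. *)
Lemma fdiff_bound Om f z a (r M : R) h : holomorphic_on Om f -> 0 < r ->
  cball z r `<=` Om -> (forall w, cball z r w -> cabs (f w) <= M) -> fdiff f z a ->
  cabs (\sum_(i < n) a i * h i) <= 4 * M / r * vabs h.
Proof.
move=> fO r0 zO fM dfz.
have [h0|hpos] := leP (vabs h) 0.
  have hE : vabs h = 0 by apply/eqP; rewrite eq_le h0 vabs_ge0.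
  by rewrite (le_trans (cabs_lin _ _)) // hE !mulr0.
have inb m : cabs m < r / vabs h -> cball z r (addpt z (scalept m h)).
  by move=> hm; rewrite cball_addpt // vabsZ -ltr_pdivlMr.
have -> : 4 * M / r * vabs h = 4 * M / (r / vabs h).
  by field; rewrite !gt_eqF.
apply: (@cauchy_bound R (fun m => f (addpt z (scalept m h)))).
- exact: divr_gt0.
- move=> m /inb/zO/fO[b bP]; exists (\sum_(i < n) b i * h i).
  exact: fdiff_line.
- apply: fdiff_line.
  have -> : addpt z (scalept 0 h) = z.
    by apply/funext => i; rewrite /addpt /scalept mul0r addr0.
  exact: dfz.
- by move=> m /inb/fM.
Qed.

(** The mean value theorem along the segment from [z] to [addpt z h], applied to the real part after
    a rotation. A ball of radius [r / 2] around any point of the segment stays in [cball z r], so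
    [fdiff_bound] gives the slope [4 * M / (r / 2)]. *)
Lemma holomorphic_lipschitz Om f z (r M : R) h : holomorphic_on Om f -> 0 < r ->
  cball z r `<=` Om -> (forall w, cball z r w -> cabs (f w) <= M) -> vabs h < r / 2 ->
  cabs (f (addpt z h) - f z) <= 8 * M / r * vabs h.
Proof.
move=> fO r0 zO fM hr; have r2 : 0 < r / 2 by lra.
have [om [om1 omE]] := Re_rotate (f (addpt z h) - f z).
pose p (t : R) := addpt z (scalept (t%:C)%C h).
have p0 : p 0 = z by apply/funext => i; rewrite /p /addpt /scalept mul0r addr0.
have p1 : p 1 = addpt z h by apply/funext => i; rewrite /p /addpt /scalept mul1r.
have inb (t : R) : `|t| <= 1 -> cball z (r / 2) (p t).
  move=> t1; rewrite cball_addpt // vabsZ cabs_real (le_lt_trans _ hr) //.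
  by rewrite ler_piMl ?vabs_ge0.
have sub (t : R) : `|t| <= 1 -> cball (p t) (r / 2) `<=` cball z r.
  by move=> /inb; exact: cball_half.
have pO (t : R) : `|t| <= 1 -> Om (p t).
  by move=> t1; apply: zO; apply: (sub t t1); exact: cball_center.
have E8 : 8 * M / r = 4 * M / (r / 2) by field; rewrite gt_eqF.
have dex (t : R) : exists c, `|t| <= 1 -> cdiff (fun m => f (addpt z (scalept m h))) (t%:C)%C c /\
    cabs c <= 8 * M / r * vabs h.
  have [t1|] := boolP (`|t| <= 1); last by exists 0.
  have [a aP] := fO _ (pO t t1); exists (\sum_(i < n) a i * h i) => _.
  split; first exact: fdiff_line.
  rewrite E8; apply: (fdiff_bound _ fO r2) (aP).
    by apply: subset_trans zO; exact: sub.
  by move=> w /(sub t t1)/fM.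
have [c cP] := choice dex.
pose F t := re (om * f (p t)).
have dF (t : R) : `|t| < 1 -> is_derive t 1 F (re (om * c t)).
  move=> t1; have [cdf _] := cP t (ltW t1); apply: approx_derive => e e0.
  have [d d0 dP] := cdf e e0; exists d => // x xd.
  have := dP (x%:C)%C; rewrite cabs_real => /(_ xd).
  have -> : (t%:C + x%:C)%C = ((t + x)%:C)%C :> C by rewrite rmorphD.
  apply: le_trans; rewrite -[leRHS]mul1r -om1 -cabsM.
  apply: le_trans (Re_le_cabs _); rewrite le_eqVlt; apply/orP; left; apply/eqP.
  congr (`|_|); rewrite /F !mulrBr mulrA.
  by case: (om * f _) (om * f _) (om * c t) => ? ? [? ?] [? ?] /=; ring.
have cF (t : R) : `|t| <= 1 -> {for t, continuous F}.
  move=> t1; have [/cdiff_lipschitz[d d0 dP] _] := cP t t1.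
  apply: (@lipschitz_at_continuous R F t (cabs (c t) + 1) d d0) => t' t'd.
  have := dP ((t' - t)%:C)%C; rewrite cabs_real => /(_ t'd).
  have -> : (t%:C + (t' - t)%:C)%C = (t'%:C)%C :> C by rewrite -rmorphD /= addrC subrK.
  apply: le_trans.
  have -> : F t' - F t = re (om * (f (p t') - f (p t))).
    by rewrite /F mulrBr; case: (om * f (p t')) (om * f (p t)) => ? ? [].
  by rewrite (le_trans (Re_le_cabs _)) // cabsM om1 mul1r.
have [||t t01 E] := @MVT_segment R F (fun t => re (om * c t)) 0 1 ler01.
- by move=> t; rewrite in_itv /= => /andP[t0 t1]; apply: dF; rewrite ger0_norm // ltW.
- apply: continuous_in_subspaceT => t; rewrite inE /= in_itv /= => /andP[t0 t1].
  by apply: cF; rewrite ger0_norm.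
move: t01; rewrite in_itv /= => /andP[t0 t1].
have t1' : `|t| <= 1 by rewrite ger0_norm.
rewrite -omE.
have -> : re (om * (f (addpt z h) - f z)) = F 1 - F 0.
  by rewrite /F p0 p1 mulrBr; case: (om * f (addpt z h)) (om * f z) => ? ? [].
rewrite E subr0 mulr1 (le_trans (ler_norm _)) // (le_trans (Re_le_cabs _)) //.
by rewrite cabsM om1 mul1r; have [] := cP t t1'.
Qed.

(** The intervals [[s k - eta k, s k + eta k]] meet pairwise; the supremum of their left ends lies
    in all of them. This yields the limit together with the explicit error at each index. *)
Lemma real_cauchy (s eta : nat -> R) :
  (forall k m, (k <= m)%N -> `|s m - s k| <= eta k) ->
  exists l, forall k, `|l - s k| <= eta k.
Proof.
move=> sE.
have eta0 k : 0 <= eta k by rewrite (le_trans _ (sE k k (leqnn k))).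
have cross k m : s k - eta k <= s m + eta m.
  have [km|/ltnW mk] := leqP k m.
    by have := sE k m km; have := eta0 m; rewrite ler_norml => ? /andP[? ?]; lra.
  by have := sE m k mk; have := eta0 k; rewrite ler_norml => ? /andP[? ?]; lra.
pose E := [set y | exists k, y = s k - eta k].
have hs : has_sup E.
  by split; [exists (s 0%N - eta 0%N), 0%N|exists (s 0%N + eta 0%N) => _ [k ->]].
exists (sup E) => k; rewrite ler_distl; apply/andP; split.
  by apply: sup_upper_bound => //; exists k.
by apply: ge_sup; [exact: hs.1|move=> _ [j ->]].
Qed.

Lemma complex_cauchy (s : nat -> C) (eta : nat -> R) :
  (forall k m, (k <= m)%N -> cabs (s m - s k) <= eta k) ->
  exists l, forall k, cabs (l - s k) <= 2 * eta k.
Proof.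
move=> sE.
have [|x xP] := @real_cauchy (fun k => re (s k)) eta.
  move=> k m /sE; apply: le_trans; apply: le_trans (Re_le_cabs _).
  by case: (s m) (s k) => ? ? [].
have [|y yP] := @real_cauchy (fun k => im (s k)) eta.
  move=> k m /sE; apply: le_trans; apply: le_trans (Im_le_cabs _).
  by case: (s m) (s k) => ? ? [].
exists (x +i* y)%C => k; rewrite (le_trans (cabs_leD _)) // mulr2n mulrDl mul1r.
have -> : re ((x +i* y)%C - s k) = x - re (s k) by case: (s k).
have -> : im ((x +i* y)%C - s k) = y - im (s k) by case: (s k).
by rewrite lerD.
Qed.

(** The Cauchy estimate makes the coefficient vectors of the [F k] at [z] a Cauchy sequence; their
    limit is the derivative of [g]. The remainder splits into that of [F k], the increment of
    [g - F k], and the error of the coefficients. *)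
Lemma weierstrass Om (F : nat -> pt R n -> C) g z (r : R) (eta : nat -> R) :
  (forall k, holomorphic_on Om (F k)) -> 0 < r -> cball z r `<=` Om ->
  (forall e, 0 < e -> exists N, forall k, (N <= k)%N -> eta k < e) ->
  (forall k m, (k <= m)%N -> forall w, cball z r w -> cabs (F m w - F k w) <= eta k) ->
  (forall k w, cball z r w -> cabs (g w - F k w) <= 2 * eta k) ->
  exists a, fdiff g z a.
Proof.
move=> FO r0 zO etacvg FE gE.
have zr := cball_center z r0.
have eta0 k : 0 <= eta k by rewrite (le_trans (cabs_ge0 _) (FE k k (leqnn k) z zr)).
have [a aP] := choice (fun k => FO k z (zO _ zr)).
have subO k m : holomorphic_on Om (fun w => F m w - F k w).
  by move=> w wO; have [b bP] := FO m w wO; have [c cP] := FO k w wO; eexists; exact: fdiff_sub bP cP.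
have acauchy i k m : (k <= m)%N -> cabs (a m i - a k i) <= 4 * eta k / r.
  move=> km; pose h : pt R n := fun j => (j == i)%:R.
  have := fdiff_bound h (subO k m) r0 zO (FE k m km) (fdiff_sub (aP m) (aP k)).
  have -> : \sum_(j < n) (a m j - a k j) * h j = a m i - a k i.
    rewrite (bigD1 i) //= /h eqxx mulr1 big1 ?addr0 // => j /negbTE ->.
    by rewrite mulr0.
  have -> : vabs h = 1.
    rewrite /vabs /dist2 (bigD1 i) //= /h eqxx subr0 cabs1 expr1n big1 ?addr0 ?sqrtr1 //.
    by move=> j /negbTE ->; rewrite subr0 cabs0 expr0n.
  by rewrite mulr1.
have bex i := complex_cauchy (acauchy i).
have [b bP] := choice bex; exists b => e e0.
(* [8 / r] comes from the Lipschitz bound [t1], and [8 * n / r] from the [n] coefficients in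
   [t3]. *)
pose K := 8 * (n%:R + 1) / r.
have K0 : 0 < K by rewrite divr_gt0 // mulr_gt0 // ltr_wpDl.
have e2K : 0 < e / 2 / K by rewrite !divr_gt0.
have [k /(_ k (leqnn k)) kP] := etacvg _ e2K.
have e2 : 0 < e / 2 by lra.
have [d [d0 dP]] := aP k _ e2.
have m0 : 0 < Num.min d (r / 2) by rewrite lt_min d0 divr_gt0.
exists (Num.min d (r / 2)); split => // h; rewrite -vabs_lt // lt_min => /andP[hd hr].
have hr' : cball z r (addpt z h) by rewrite cball_addpt //; lra.
have h0 := vabs_ge0 h.
pose T := \sum_(i < n) (b i - a k i) * h i.
have E : g (addpt z h) - g z - \sum_(i < n) b i * h i =
   ((g (addpt z h) - F k (addpt z h)) - (g z - F k z)) +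
   (F k (addpt z h) - F k z - \sum_(i < n) a k i * h i) - T.
  have -> : T = \sum_(i < n) b i * h i - \sum_(i < n) a k i * h i.
    by rewrite -sumrB; apply: eq_bigr => i _; rewrite mulrBl.
  by ring.
(* Holomorphy of [g] is what is being proved, so the Lipschitz bound is applied to [F m - F k] with
   [m] large; replacing [F m] by [g] at two points costs at most [4 * eta m < x]. *)
have t1 : cabs ((g (addpt z h) - F k (addpt z h)) - (g z - F k z)) <= 8 * eta k / r * vabs h.
  apply/ler_addgt0Pr => x x0; have x4 : 0 < x / 4 by lra.
  have [N NP] := etacvg _ x4; pose m := maxn N k.
  have mx := NP m (leq_maxl _ _).
  have km : (k <= m)%N := leq_maxr _ _.
  have hr2 : vabs h < r / 2 by [].
  have L := holomorphic_lipschitz (subO k m) r0 zO (FE k m km) hr2.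
  have -> : (g (addpt z h) - F k (addpt z h)) - (g z - F k z) =
    (F m (addpt z h) - F k (addpt z h) - (F m z - F k z)) +
    ((g (addpt z h) - F m (addpt z h)) - (g z - F m z)) by ring.
  rewrite (le_trans (cabsD _ _)) // lerD // (le_trans (cabsB _ _)) //.
  have := gE m _ zr; have := gE m _ hr'; lra.
have t2 : cabs (F k (addpt z h) - F k z - \sum_(i < n) a k i * h i) <= e / 2 * vabs h.
  by apply: dP; rewrite -vabs_lt.
have t3 : cabs T <= n%:R * (2 * (4 * eta k / r)) * vabs h.
  rewrite (le_trans (cabs_lin _ _)) // ler_wpM2r //.
  rewrite -[n in n%:R]card_ord -sum1_card natr_sum mulr_suml.
  by apply: ler_sum => i _; rewrite mul1r.
rewrite E (le_trans (cabsB _ _)) // (le_trans (lerD (cabsD _ _) (lexx _))) //.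
have t4 : K * eta k <= e / 2 by rewrite mulrC -ler_pdivlMr // ltW.
have : K * eta k * vabs h <= e / 2 * vabs h by rewrite ler_wpM2r.
have -> : K * eta k * vabs h =
   8 * eta k / r * vabs h + n%:R * (2 * (4 * eta k / r)) * vabs h by rewrite /K; ring.
lra.
Qed.

End SeveralVariables.

(** * The iterated integral as an integral *)

(* The library's own sigma-finite instance on [m1 \x m2] is shadowed by the one
   for subprobabilities, hence the alias. *)
Section SigmaFiniteProduct.
Local Open Scope ereal_scope.
Context d1 d2 (T1 : measurableType d1) (T2 : measurableType d2) (R : realType).
Variables (m1 : {sigma_finite_measure set T1 -> \bar R})
  (m2 : {sigma_finite_measure set T2 -> \bar R}).

Definition sf_product : set (T1 * T2) -> \bar R := m1 \x m2.

HB.instance Definition _ := Measure.copy sf_product (m1 \x m2).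

Lemma sf_product_sigma_finite : sigma_finite setT sf_product.
Proof.
have /sigma_finiteP[F [TF ndF Foo]] := sigma_finiteT m1.
have /sigma_finiteP[G [TG ndG Goo]] := sigma_finiteT m2.
exists (fun n => F n `*` G n).
  rewrite -setXTT TF TG; apply/seteqP; split=> [[x y] [/= [n _ Fx] [k _ Gy]]|[x y] [n _ [/= Fx Gy]]].
    exists (maxn n k) => //; split.
      by move: x Fx; exact/subsetPset/ndF/leq_maxl.
    by move: y Gy; exact/subsetPset/ndG/leq_maxr.
  by split; exists n.
move=> k; have [? ?] := Foo k; have [? ?] := Goo k; split; first exact: measurableX.
by rewrite /sf_product product_measure1E // lte_mul_pinfty // ge0_fin_numE.
Qed.

HB.instance Definition _ := Measure_isSigmaFinite.Build _ _ _ sf_product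
  sf_product_sigma_finite.

End SigmaFiniteProduct.

Section MeasureModel.
Context {R : realType}.
Local Open Scope ereal_scope.

(** Each variable adds a factor to a product space, and Tonelli's theorem identifies the iterated
    integral with the integral there as soon as the integrand is measurable. Finiteness on cubes
    later gives bounded sets finite volume. *)
Lemma iint_model (m : nat) : exists (d : measure_display) (T : measurableType d)
    (mu : {sigma_finite_measure set T -> \bar R}) (e : T -> nat -> R),
  [/\ forall i, measurable_fun [set: T] (fun x => e x i),
      forall F : (nat -> R) -> \bar R, (forall x, 0 <= F x) ->
        measurable_fun [set: T] (fun x => F (e x)) -> iint m F = \int[mu]_x F (e x) &
      forall M : R, mu [set x | forall i, (i < m)%N -> (`|e x i| <= M)%R] < +oo].
Proof.
elim: m => [|m [d [T [mu [e [me eint ebd]]]]]].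
  (* Any space of total mass one would do: [iint 0] evaluates at the zero sequence, the constant
     value of the coordinate map. *)
  exists _, (measurableTypeR R), (dirac (0%R : measurableTypeR R)), (fun _ _ => 0%R); split.
  - by move=> i; exact: measurable_cst.
  - by move=> F F0 mF; rewrite /= integral_dirac // diracT mul1e.
  - move=> M; rewrite (_ : [set x | _] = setT); last by apply/seteqP; split.
    by rewrite /= /dirac indicT ltry.
exists _, _, (sf_product (@lebesgue_measure R) mu), (fun x => scons x.1 (e x.2)); split.
- move=> [|i] /=; first exact: measurable_fst.
  exact: (measurableT_comp (me i) measurable_snd).
- move=> F F0 mF; rewrite /= /sf_product fubini_tonelli1 //.
  apply: eq_integral => t _; rewrite /fubini_F; apply: eint => //.
  exact: (measurableT_comp mF (measurable_pair1 t)).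
move=> M.
rewrite (_ : [set x | _] = [set t | (`|t| <= M)%R] `*`
   [set x | forall i, (i < m)%N -> (`|e x i| <= M)%R]); last first.
  apply/seteqP; split => -[t x] /=.
    by move=> H; split; [exact: (H 0%N)|move=> i im; exact: (H i.+1)].
  by move=> [h1 h2] [|i] //= im; exact: h2.
have E1 : [set t : R | (`|t| <= M)%R] = `[(- M)%R, M]%classic.
  by apply/seteqP; split => t /=; rewrite in_itv /= ler_norml.
have m2 : measurable [set x | forall i, (i < m)%N -> (`|e x i| <= M)%R].
  rewrite (_ : [set x | _] =
      \bigcap_(i in [set i | (i < m)%N]) ((fun x => e x i) @^-1` `[(- M)%R, M]%classic)); last first.
    apply/seteqP; split => x /= H i im.
      by rewrite /= in_itv /= -ler_norml; exact: H.
    by have := H i im; rewrite /= in_itv /= -ler_norml.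
  by apply: bigcap_measurableType => i _; rewrite -[X in measurable X]setTI; exact: (me i measurableT _ (measurable_itv _)).
rewrite E1 /= /sf_product product_measure1E // lte_mul_pinfty //.
have := @lebesgue_measure_itv R `[(- M)%R, M]%R.
by rewrite /= => ->; case: ifP => //; rewrite -EFinD.
Qed.

End MeasureModel.

(** * Rational boxes as a countable base of the topology *)

Section RationalBoxes.
Context {R : realType} {n : nat}.
Local Notation C := R[i].
Implicit Types (z w : pt R n) (U : set (pt R n)).

(** Rational centre and one rational half side: a countable type, enumerated by [pickle]. *)
Definition box_index := ({ffun 'I_n -> rat * rat} * rat)%type.

Definition rbox (k : box_index) : set (pt R n) :=
  [set z | forall i, `|re (z i) - ratr (k.1 i).1| < ratr k.2 /\
                     `|im (z i) - ratr (k.1 i).2| < ratr k.2].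

(** The inverse of one plus the sum of all inverses; unlike a minimum it makes sense for empty [I],
    that is, in dimension 0. *)
Lemma common_lower_bound (I : finType) (r : I -> R) : (forall i, 0 < r i) ->
  exists2 s, 0 < s & forall i, s <= r i.
Proof.
move=> r0; pose M := 1 + \sum_i (r i)^-1.
have S0 : 0 <= \sum_i (r i)^-1 by apply: sumr_ge0 => i _; rewrite invr_ge0 ltW.
have M0 : 0 < M by rewrite /M; lra.
exists M^-1 => [|i]; first by rewrite invr_gt0.
rewrite -[leRHS]invrK lef_pV2 ?posrE ?invr_gt0 //.
rewrite /M (bigD1 i) //=; set S := \sum_(j | _) _.
have : 0 <= S by apply: sumr_ge0 => j _; rewrite invr_ge0 ltW.
lra.
Qed.

Lemma rbox_open k z : rbox k z -> exists2 r : R, 0 < r & cball z r `<=` rbox k.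
Proof.
move=> kz.
pose r i := Num.min (ratr k.2 - `|re (z i) - ratr (k.1 i).1|)
                    (ratr k.2 - `|im (z i) - ratr (k.1 i).2|).
have [i|s s0 sr] := @common_lower_bound 'I_n r.
  by have [h1 h2] := kz i; rewrite lt_min !subr_gt0 h1.
exists s => // w; rewrite -(addpt_sub z w) cball_addpt // => hs i.
have hi := le_lt_trans (cabs_le_vabs (fun i => w i - z i) i) hs.
have := sr i; rewrite addpt_sub le_min => /andP[hr hm].
have hre := le_lt_trans (Re_le_cabs _) hi; have him := le_lt_trans (Im_le_cabs _) hi.
have Ere : re (w i) = re (z i) + re (w i - z i) by case: (w i) (z i) => ? ? [? ?] /=; ring.
have Eim : im (w i) = im (z i) + im (w i - z i) by case: (w i) (z i) => ? ? [? ?] /=; ring.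
rewrite Ere Eim; split.
- have := ler_normD (re (z i) - ratr (k.1 i).1) (re (w i - z i)).
  by rewrite addrAC; lra.
- have := ler_normD (im (z i) - ratr (k.1 i).2) (im (w i - z i)).
  by rewrite addrAC; lra.
Qed.

Lemma rat_near (x e : R) : 0 < e -> exists q : rat, `|x - ratr q| < e.
Proof.
move=> e0; have [|q] := @rat_in_itvoo R (x - e) (x + e); first by lra.
by rewrite in_itv /= => /andP[h1 h2]; exists q; rewrite ltr_norml; lra.
Qed.

Lemma rbox_base U z : c_open U -> U z -> exists k, rbox k z /\ rbox k `<=` U.
Proof.
move=> oU /oU[r [r0 rU]].
(* The centre is chosen within the half side of [z], so each coordinate of a point of the box
   differs from that of [z] by at most 4 half sides; the squared distance is at most [16 * n] half
   sides squared, below that of [N] half sides. *)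
pose N : R := 8 * (n%:R + 1).
have N0 : 0 < N by rewrite mulr_gt0 // ltr_wpDl.
have [|q] := @rat_in_itvoo R 0 (Num.min 1 r / N).
  by rewrite divr_gt0 // lt_min ltr01.
rewrite in_itv /= => /andP[q0 qr].
have [f fP] := choice (fun i => rat_near (re (z i)) q0).
have [g gP] := choice (fun i => rat_near (im (z i)) q0).
exists ([ffun i => (f i, g i)], q); split.
  by move=> i /=; rewrite ffunE.
move=> w kw; apply: rU; rewrite /cball /= /dist2.
have wz i : cabs (w i - z i) <= 4 * ratr q.
  rewrite (le_trans (cabs_leD _)) //.
  have [] := kw i; rewrite /= ffunE /= => h1 h2.
  have := fP i; have := gP i.
  have -> : re (w i - z i) = re (w i) - re (z i) by case: (w i) (z i) => ? ? [].
  have -> : im (w i - z i) = im (w i) - im (z i) by case: (w i) (z i) => ? ? [].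
  have := ler_distD (ratr (f i)) (re (w i)) (re (z i)).
  have := ler_distD (ratr (g i)) (im (w i)) (im (z i)).
  rewrite (distrC (ratr (f i))) (distrC (ratr (g i))); lra.
have qN : N * ratr q < Num.min 1 r by rewrite mulrC -ltr_pdivlMr.
have [q1 qr'] : N * ratr q < 1 /\ N * ratr q < r by move: qN; rewrite lt_min => /andP.
have le1 : \sum_(i < n) cabs (w i - z i) ^+ 2 <= n%:R * (4 * ratr q) ^+ 2.
  rewrite -[n in n%:R]card_ord -sum1_card natr_sum mulr_suml.
  apply: ler_sum => i _; rewrite mul1r lerXn2r // nnegrE ?cabs_ge0 //.
  by rewrite mulr_ge0 // ltW.
apply: (le_lt_trans le1); apply: (@le_lt_trans _ _ ((N * ratr q) ^+ 2)).
  have -> : n%:R * (4 * ratr q) ^+ 2 = n%:R * 16 * ratr q ^+ 2 :> R by ring.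
  rewrite [leRHS]exprMn ler_wpM2r ?sqr_ge0 // /N.
  by have n0 : 0 <= n%:R :> R by []; nra.
have : 0 < N * ratr q by rewrite mulr_gt0.
by move: qr'; set a := N * ratr q; nra.
Qed.

End RationalBoxes.

(** * Volume integrals and measurability through real coordinates *)

Section VolumeModel.
Context {R : realType} {n : nat}.
Local Notation C := R[i].

Lemma vint_model : exists (d : measure_display) (T : measurableType d)
    (mu : {sigma_finite_measure set T -> \bar R}) (phi : T -> pt R n),
  [/\ forall i, measurable_fun [set: T] (fun x => re (phi x i)),
      forall i, measurable_fun [set: T] (fun x => im (phi x i)),
      forall G : pt R n -> \bar R, (forall z, 0 <= G z)%E ->
        measurable_fun [set: T] (fun x => G (phi x)) ->
        vint G = (\int[mu]_x G (phi x))%E &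
      forall M : R, (mu [set x | forall i,
        (`|re (phi x i)| <= M /\ `|im (phi x i)| <= M)%R] < +oo)%E].
Proof.
have [d [T [mu [e [me eint ebd]]]]] := @iint_model R (2 * n).
exists d, T, mu, (fun x => @toC R n (e x)); split.
- by move=> i; exact: me.
- by move=> i; exact: me.
- by move=> G G0 mG; rewrite /vint eint.
move=> M; have := ebd M; congr (mu _ < _)%E; apply/seteqP; split=> x /= H.
  move=> i; have := ltn_ord i; move: (nat_of_ord i) => j jn.
  by split; apply: H; lia.
move=> i i2n; have jn : (i./2 < n)%N by lia.
have [h1 h2] := H (Ordinal jn).
have [odd_i|even_i] := boolP (odd i).
  by have := h2; congr (`|e x _| <= _); rewrite /=; lia.
by have := h1; congr (`|e x _| <= _); rewrite /=; lia.
Qed.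

Context d (T : measurableType d) (phi : T -> pt R n).
Hypothesis mre : forall i, measurable_fun [set: T] (fun x => re (phi x i)).
Hypothesis mim : forall i, measurable_fun [set: T] (fun x => im (phi x i)).

Lemma measurable_rbox k : measurable (phi @^-1` rbox k).
Proof.
rewrite (_ : _ @^-1` _ = \bigcap_(i in [set: 'I_n])
  ((fun x => re (phi x i)) @^-1` `](ratr (k.1 i).1 - ratr k.2), (ratr (k.1 i).1 + ratr k.2)[ `&`
   (fun x => im (phi x i)) @^-1` `](ratr (k.1 i).2 - ratr k.2), (ratr (k.1 i).2 + ratr k.2)[)).
  apply: fin_bigcap_measurable => // i _; apply: measurableI.
    rewrite -[X in measurable X]setTI; exact: (mre i measurableT (measurable_itv _)).
  rewrite -[X in measurable X]setTI; exact: (mim i measurableT (measurable_itv _)).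
apply/seteqP; split => x /=.
  by move=> H i _; have [h1 h2] := H i; rewrite /= !in_itv /= -!ltr_distl.
by move=> H i; have := H i I; rewrite /= !in_itv /= -!ltr_distl.
Qed.

(** An open set is the union of the rational boxes it contains, and this union is countable; codes
    of no such box contribute the empty set. *)
Lemma measurable_c_open U : c_open U -> measurable (phi @^-1` U).
Proof.
move=> oU.
rewrite (_ : _ @^-1` _ = \bigcup_(j in [set: nat])
   if unpickle j is Some k then
     if `[< rbox k `<=` U >] then phi @^-1` rbox k else set0
   else set0).
  apply: bigcup_measurable => j _; case: unpickle => [k|//].
  by case: asboolP => // _; exact: measurable_rbox.
apply/seteqP; split => x /=.
  move=> /(rbox_base oU)[k [kx kU]]; exists (pickle k) => //.
  by rewrite pickleK; case: asboolP.
by move=> [j _]; case: unpickle => [k|//]; case: asboolP => // kU /kU.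
Qed.

(** For [y >= 0] the set where the product exceeds [y] is an open subset of [A]; for [y < 0] it is
    everything. *)
Lemma measurable_indic_continuous (A : set (pt R n)) (G : pt R n -> R) : c_open A ->
  (forall z, 0 <= G z) ->
  (forall z, A z -> forall e, 0 < e -> exists r, 0 < r /\
     forall w, cball z r w -> `|G w - G z| < e) ->
  measurable_fun [set: T] (fun x => \1_A (phi x) * G (phi x)).
Proof.
move=> oA G0 cG mD; apply: (measurability _ (RGenOInfty.measurableE R)) => //.
move=> /= _ [_ [y ->] <-]; rewrite setTI.
have [y0|y0] := ltP y 0.
  rewrite (_ : _ @^-1` _ = setT) //; apply/seteqP; split => // x _ /=.
  by rewrite in_itv /= andbT (lt_le_trans y0) // mulr_ge0.
rewrite (_ : _ @^-1` _ = phi @^-1` [set z | A z /\ y < G z]).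
  apply: measurable_c_open => z /= [Az yG].
  have [r [r0 rA]] := oA z Az.
  have Gy : 0 < G z - y by lra.
  have [s [s0 sG]] := cG z Az _ Gy.
  exists (Num.min r s); split; first by rewrite lt_min r0.
  have m0 : 0 <= Num.min r s by rewrite le_min !ltW.
  move=> w wm; split; first by apply: rA; apply: sub_cball wm => //; rewrite ge_min lexx.
  have := sG w; rewrite ltr_norml => H.
  have /H : cball z s w by apply: sub_cball wm => //; rewrite ge_min lexx orbT.
  by lra.
apply/seteqP; split => x /=; rewrite in_itv /= andbT indicE.
  have [|_] := boolP (phi x \in A); first by rewrite inE mul1r.
  by rewrite mul0r ltNge y0.
by move=> [Ax yG]; rewrite mem_set // mul1r.
Qed.

End VolumeModel.

(** * L^p integrals of holomorphic functions *)

Section Convergence.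
Context {R : realType}.

Lemma powR_cvg_base (a : nat -> R) (l p : R) : (forall k, 0 <= a k) -> 0 <= l -> 0 < p ->
  a @ \oo --> l -> (fun k => a k `^ p) @ \oo --> l `^ p.
Proof.
move=> a0; rewrite le_eqVlt => /predU1P[<-|l0] p0 al.
  rewrite powR0 ?gt_eqF //; apply/cvgrPdist_lt => e e0.
  have ep : 0 < e `^ p^-1 by rewrite powR_gt0.
  move/cvgrPdist_lt : al => /(_ _ ep); apply: filterS => k.
  rewrite !sub0r !normrN !ger0_norm ?powR_ge0 // => ake.
  rewrite -[e](@powRr1 _ e) ?ltW // -(@mulVf _ p) ?gt_eqF // powRrM.
  by rewrite gt0_ltr_powR // nnegrE ?powR_ge0.
have H : (fun k => expR (p * ln (a k))) @ \oo --> expR (p * ln l).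
  apply: continuous_cvg; first exact: continuous_expR.
  apply: cvgMr; apply: continuous_cvg al; exact: continuous_ln.
rewrite {2}/powR gt_eqF //; apply: cvg_trans H; apply: near_eq_cvg.
move/cvgrPdist_lt : al => /(_ _ l0); apply: filterS => k.
rewrite /powR ltr_distlC subrr => /andP[ak _].
by rewrite gt_eqF.
Qed.

Lemma powR_cvg_exponent (a : R) (s : nat -> R) (q : R) : (forall k, 0 < s k) -> 0 < q ->
  s @ \oo --> q -> (fun k => a `^ s k) @ \oo --> a `^ q.
Proof.
move=> s0 q0 sq; have [->|a0] := eqVneq a 0.
  rewrite (_ : (fun k => _) = (fun=> 0)); last first.
    by apply/funext => k; rewrite powR0 // gt_eqF.
  by rewrite powR0 ?gt_eqF //; exact: cvg_cst.
rewrite /powR (negbTE a0); apply: continuous_cvg; first exact: continuous_expR.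
exact: cvgMl.
Qed.

Lemma measurable_fun_powR d (T : measurableType d) (f : T -> R) (p : R) :
  measurable_fun [set: T] f -> measurable_fun [set: T] (fun x => f x `^ p).
Proof. exact: (@measurableT_comp _ _ _ _ _ _ (@powR R ^~ p)). Qed.

Lemma fatou_bound d (T : measurableType d) (mu : {measure set T -> \bar R})
    (u_ : nat -> T -> R) (u : T -> R) (M : \bar R) :
  (forall k, measurable_fun [set: T] (u_ k)) -> (forall k x, 0 <= u_ k x) ->
  (forall x, (fun k => u_ k x) @ \oo --> u x) ->
  (forall k, (\int[mu]_x (u_ k x)%:E <= M)%E) -> (\int[mu]_x (u x)%:E <= M)%E.
Proof.
move=> mu_ u0 cu uM.
have := @fatou _ _ _ mu _ measurableT (fun k x => (u_ k x)%:E).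
move=> /(_ (fun k => proj2 (measurable_EFinP _ _) (mu_ k))).
have u0' k x : [set: T] x -> (0 <= (u_ k x)%:E)%E by rewrite lee_fin.
move=> /(_ u0') H; apply: (@le_trans _ _ (limn_einf (fun k => \int[mu]_x (u_ k x)%:E))%E).
  apply: le_trans H; rewrite le_eqVlt; apply/orP; left; apply/eqP.
  apply: eq_integral => x _.
  have c : (fun k => (u_ k x)%:E) @ \oo --> (u x)%:E.
    by apply/fine_cvgP; split; [exact: nearW|exact: cu].
  by rewrite (cvg_limn_einf_sup c).1.
rewrite limn_einf_lim; apply: lime_le; first exact: is_cvg_einfs.
apply: nearW => k; apply: le_trans (uM k).
by apply: ereal_inf_lbound; exists k => //=.
Qed.

End Convergence.

Section LpIntegrals.
Context {R : realType} {n : nat}.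
Local Notation C := R[i].
Implicit Types (A B Om : set (pt R n)) (f g : pt R n -> C) (p q : R).

Lemma holomorphic_sub A B f : A `<=` B -> holomorphic_on B f -> holomorphic_on A f.
Proof. by move=> AB fB z /AB/fB. Qed.

Lemma holomorphic_subr A f g : holomorphic_on A f -> holomorphic_on A g ->
  holomorphic_on A (fun z => f z - g z).
Proof.
by move=> fA gA z Az; have [a aP] := fA z Az; have [b bP] := gA z Az; eexists; exact: fdiff_sub aP bP.
Qed.

Lemma holomorphic_scale A f (c : C) : holomorphic_on A f -> holomorphic_on A (fun z => c * f z).
Proof. by move=> fA z Az; have [a aP] := fA z Az; eexists; exact: fdiffZ aP. Qed.

(** With the indicator inside the power, harmless for [p > 0], [Lp_int A p f] integrates the [p]-th
    power of one function on the whole space, the form Minkowski's inequality requires. *)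
Definition indic_abs A f z : R := \1_A z * cabs (f z).

Lemma indic_abs_ge0 A f z : 0 <= indic_abs A f z.
Proof. by rewrite mulr_ge0 // cabs_ge0. Qed.

Lemma indic_abs_powR A f z p : 0 < p -> \1_A z * cabs (f z) `^ p = indic_abs A f z `^ p.
Proof.
move=> p0; rewrite /indic_abs indicE; case: (_ \in _); first by rewrite !mul1r.
by rewrite !mul0r powR0 // gt_eqF.
Qed.

Lemma measurable_indic_abs d (T : measurableType d) (phi : T -> pt R n) A f :
  (forall i, measurable_fun [set: T] (fun x => re (phi x i))) ->
  (forall i, measurable_fun [set: T] (fun x => im (phi x i))) ->
  c_open A -> holomorphic_on A f ->
  measurable_fun [set: T] (fun x => indic_abs A f (phi x)).
Proof.
move=> mre mim oA fA; apply: (@measurable_indic_continuous R n _ _ phi mre mim A (fun z => cabs (f z))) => //.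
  by move=> z; exact: cabs_ge0.
move=> z Az e e0; have [a aP] := fA z Az.
have [r [r0 rP]] := fdiff_continuous aP e0; exists r; split => // w /rP.
apply: le_lt_trans; rewrite ler_norml.
have := cabsD (f w - f z) (f z); have := cabsD (f z - f w) (f w).
rewrite !subrK cabsBC; lra.
Qed.

(* The iterated integrals are replaced, for all [A], [f] and [p] at once, by
   integrals over a single measure space. *)
Lemma Lp_int_model : exists (d : measure_display) (T : measurableType d)
    (mu : {sigma_finite_measure set T -> \bar R}) (phi : T -> pt R n),
  [/\ forall A, c_open A -> measurable (phi @^-1` A),
      forall A f, c_open A -> holomorphic_on A f ->
        measurable_fun [set: T] (fun x => indic_abs A f (phi x)),
      forall A f p, c_open A -> holomorphic_on A f -> 0 < p ->
        Lp_int A p f = (\int[mu]_x (indic_abs A f (phi x) `^ p)%:E)%E &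
      forall A, c_open A -> c_bounded A -> (mu (phi @^-1` A) < +oo)%E].
Proof.
have [d [T [mu [phi [mre mim vE bd]]]]] := @vint_model R n.
have mW A f := @measurable_indic_abs d T phi A f mre mim.
exists d, T, mu, phi; split => //.
- by move=> A; exact: measurable_c_open.
- move=> A f p oA fA p0; rewrite /Lp_int vE.
  + by apply: eq_integral => x _; rewrite indic_abs_powR.
  + by move=> z; rewrite lee_fin mulr_ge0 // powR_ge0.
  + apply/measurable_EFinP.
    rewrite (_ : (fun x => _) = (fun x => indic_abs A f (phi x) `^ p)).
      exact: measurable_fun_powR (mW _ _ oA fA).
    by apply/funext => x; rewrite indic_abs_powR.
- move=> A oA [M AM]; apply: le_lt_trans (bd (1 + M)); apply: le_measure.
  + by rewrite inE; exact: measurable_c_open.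
  + rewrite inE (_ : [set x | _] = \bigcap_(i in [set: 'I_n])
     ((fun x => re (phi x i)) @^-1` `[- (1 + M), 1 + M] `&`
      (fun x => im (phi x i)) @^-1` `[- (1 + M), 1 + M])).
      apply: fin_bigcap_measurable => // i _; apply: measurableI.
        rewrite -[X in measurable X]setTI; exact: (mre i measurableT _ (measurable_itv _)).
      rewrite -[X in measurable X]setTI; exact: (mim i measurableT _ (measurable_itv _)).
    apply/seteqP; split => x /= H i.
      by move=> _ /=; rewrite !in_itv /= -!ler_norml; exact: H.
    by have := H i I; rewrite /= !in_itv /= -!ler_norml.
  + move=> x /= /AM xM i; have c1 := coord_le i xM.
    by split; apply: le_trans c1; [exact: Re_le_cabs|exact: Im_le_cabs].
Qed.

(** Extended-valued, so that a divergent integral has norm [+oo]; through [fine], as in [Lp_norm],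
    it would read 0. *)
Definition enorm A p f : \bar R := (Lp_int A p f `^ p^-1)%E.

Lemma Lp_int_ge0 A p f : c_open A -> holomorphic_on A f -> 0 < p -> (0 <= Lp_int A p f)%E.
Proof.
move=> oA fA p0; have [d [T [mu [phi [_ _ LE _]]]]] := Lp_int_model.
by rewrite LE //; apply: integral_ge0 => x _; rewrite lee_fin powR_ge0.
Qed.

Lemma Lp_int_eq A p f g : (forall z, A z -> cabs (f z) = cabs (g z)) -> Lp_int A p f = Lp_int A p g.
Proof.
move=> fg; congr (vint _); apply/funext => z; rewrite indicE.
by have [|] := boolP (z \in A); rewrite ?mul0r // inE => /fg ->.
Qed.

Lemma Lp_int_mono A B p f : c_open A -> c_open B -> A `<=` B -> holomorphic_on B f -> 0 < p ->
  (Lp_int A p f <= Lp_int B p f)%E.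
Proof.
move=> oA oB AB fB p0; have fA := holomorphic_sub AB fB.
have [d [T [mu [phi [_ mW LE _]]]]] := Lp_int_model.
rewrite !LE //; apply: ge0_le_integral => //.
- by move=> x _; rewrite lee_fin powR_ge0.
- by apply/measurable_EFinP; exact: measurable_fun_powR (mW _ _ oA fA).
- by apply/measurable_EFinP; exact: measurable_fun_powR (mW _ _ oB fB).
move=> x _; rewrite lee_fin (ge0_ler_powR (ltW p0)) ?nnegrE ?indic_abs_ge0 //.
rewrite /indic_abs ler_wpM2r ?cabs_ge0 // !indicE.
have [xA|_] := boolP (phi x \in A); last by rewrite ler0n.
by rewrite mem_set //; apply: AB; rewrite inE in xA.
Qed.

Lemma Lp_int_exponent Om : c_open Om -> c_bounded Om -> exists2 V : R, 0 <= V &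
  forall A f p q, c_open A -> A `<=` Om -> holomorphic_on A f -> 0 < p -> p <= q ->
   (Lp_int A p f <= V%:E + Lp_int A q f)%E.
Proof.
move=> oOm bOm; have [d [T [mu [phi [mo mW LE bd]]]]] := Lp_int_model.
have fin : mu (phi @^-1` Om) \is a fin_num by rewrite ge0_fin_numE // bd.
exists (fine (mu (phi @^-1` Om))); first exact: fine_ge0.
move=> A f p q oA AO fA p0 pq; have q0 : 0 < q by exact: lt_le_trans pq.
rewrite !LE //.
apply: (@le_trans _ _ (\int[mu]_x ((\1_(phi @^-1` A) x)%:E + (indic_abs A f (phi x) `^ q)%:E))%E).
  have mp r : measurable_fun [set: T] (fun x => (indic_abs A f (phi x) `^ r)%:E).
    by apply/measurable_EFinP; exact: measurable_fun_powR (mW _ _ oA fA).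
  apply: ge0_le_integral => //.
  - by move=> x _; rewrite lee_fin powR_ge0.
  - by apply: emeasurable_funD => //; apply/measurable_EFinP; exact: measurable_indic (mo A oA).
  move=> x _; rewrite -EFinD lee_fin.
  have -> : \1_(phi @^-1` A) x = \1_A (phi x) :> R by [].
  rewrite /indic_abs indicE; case: (_ \in _).
    rewrite !mul1r; have [c1|c1] := leP (cabs (f (phi x))) 1.
      apply: (@le_trans _ _ 1); last by rewrite lerDl powR_ge0.
      by apply: (le_trans (ge0_ler_powR (ltW p0) _ _ c1)); rewrite ?nnegrE ?cabs_ge0 ?ler01 ?powR1.
    by apply: (@le_trans _ _ (cabs (f (phi x)) `^ q)); [rewrite ler_powR // ltW|rewrite lerDr].
  by rewrite !mul0r !powR0 ?gt_eqF // addr0.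
rewrite ge0_integralD //.
- apply: leeD2r; rewrite integral_indic //; last exact: mo.
  rewrite setIT fineK //; apply: le_measure; rewrite ?inE; [exact: mo|exact: mo|].
  by move=> x; exact: AO.
- by apply/measurable_EFinP; exact: measurable_indic (mo A oA).
- by move=> x _; rewrite lee_fin powR_ge0.
- by apply/measurable_EFinP; exact: measurable_fun_powR (mW _ _ oA fA).
Qed.

Lemma Lp_int_fatou A p (F : nat -> pt R n -> C) f (M : \bar R) : c_open A -> 0 < p ->
  (forall k, holomorphic_on A (F k)) -> holomorphic_on A f ->
  (forall z, A z -> (fun k => cabs (F k z)) @ \oo --> cabs (f z)) ->
  (forall k, (Lp_int A p (F k) <= M)%E) -> (Lp_int A p f <= M)%E.
Proof.
move=> oA p0 FA fA Ff FM; have [d [T [mu [phi [_ mW LE _]]]]] := Lp_int_model.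
rewrite LE //; apply: (@fatou_bound R _ _ mu (fun k x => indic_abs A (F k) (phi x) `^ p)).
- by move=> k; exact: measurable_fun_powR (mW _ _ oA (FA k)).
- by move=> k x; exact: powR_ge0.
- move=> x; apply: powR_cvg_base => //; [by move=> k; exact: indic_abs_ge0|exact: indic_abs_ge0|].
  rewrite /indic_abs indicE; have [xA|_] := boolP (phi x \in A).
    by apply: cvgMr; apply: Ff; rewrite inE in xA.
  under eq_fun do rewrite mul0r.
  by rewrite mul0r; exact: cvg_cst.
- by move=> k; rewrite -LE.
Qed.

Lemma Lp_int_fatou_exponent A (s : nat -> R) q f (M : \bar R) : c_open A ->
  holomorphic_on A f -> (forall k, 0 < s k) -> 0 < q -> s @ \oo --> q ->
  (forall k, (Lp_int A (s k) f <= M)%E) -> (Lp_int A q f <= M)%E.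
Proof.
move=> oA fA s0 q0 sq FM; have [d [T [mu [phi [_ mW LE _]]]]] := Lp_int_model.
rewrite LE //; apply: (@fatou_bound R _ _ mu (fun k x => indic_abs A f (phi x) `^ s k)).
- by move=> k; exact: measurable_fun_powR (mW _ _ oA fA).
- by move=> k x; exact: powR_ge0.
- by move=> x; exact: powR_cvg_exponent.
- by move=> k; rewrite -LE.
Qed.

Lemma enorm_ge0 A p f : (0 <= enorm A p f)%E.
Proof. exact: poweR_ge0. Qed.

Lemma enormZ A p f (c : C) : c_open A -> holomorphic_on A f -> 0 < p ->
  enorm A p (fun z => c * f z) = ((cabs c)%:E * enorm A p f)%E.
Proof.
move=> oA fA p0; have [d [T [mu [phi [_ mW LE _]]]]] := Lp_int_model.
rewrite /enorm LE //; last exact: holomorphic_scale.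
have E x : (indic_abs A (fun z => c * f z) (phi x) `^ p)%:E =
    ((cabs c `^ p)%:E * (indic_abs A f (phi x) `^ p)%:E)%E.
  by rewrite /indic_abs cabsM mulrCA powRM ?mulr_ge0 ?cabs_ge0.
under eq_integral do rewrite E.
rewrite ge0_integralZl_EFin ?powR_ge0 //; last first.
- by apply/measurable_EFinP; exact: measurable_fun_powR (mW _ _ oA fA).
- by move=> x _; rewrite lee_fin powR_ge0.
rewrite -LE // poweRM ?lee_fin ?powR_ge0 //; last exact: Lp_int_ge0.
by rewrite poweR_EFin -powRrM mulfV ?gt_eqF // powRr1 // cabs_ge0.
Qed.

(** Minkowski's inequality in the measure model. The hypothesis is a pointwise bound of moduli, so
    that it covers sums, differences and telescoping alike. *)
Lemma enorm_triangle A p f g h : c_open A -> 1 <= p ->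
  holomorphic_on A f -> holomorphic_on A g -> holomorphic_on A h ->
  (forall z, A z -> cabs (f z) <= cabs (g z) + cabs (h z)) ->
  (enorm A p f <= enorm A p g + enorm A p h)%E.
Proof.
move=> oA p1 fA gA hA fgh; have p0 : 0 < p by exact: lt_le_trans p1.
have [d [T [mu [phi [_ mW LE _]]]]] := Lp_int_model.
have NE u : holomorphic_on A u ->
    enorm A p u = ('N[mu]_p%:E[EFin \o (fun x => indic_abs A u (phi x))])%E.
  move=> uA; rewrite /enorm LE // unlock; congr (_ `^ _)%E.
  by apply: eq_integral => x _; rewrite /= ger0_norm ?indic_abs_ge0 // poweR_EFin.
rewrite (NE g) // (NE h) //; apply: le_trans (minkowski_EFin _ (mW _ _ oA gA) (mW _ _ oA hA) p1).
rewrite /enorm LE // unlock; apply: gt0_ler_poweR.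
- by rewrite invr_ge0 ltW.
- by rewrite in_itv /= leey andbT; apply: integral_ge0 => x _; rewrite lee_fin powR_ge0.
- by rewrite in_itv /= leey andbT; apply: integral_ge0 => x _; rewrite lee_fin powR_ge0.
have Wgh0 x : 0 <= indic_abs A g (phi x) + indic_abs A h (phi x).
  by rewrite addr_ge0 ?indic_abs_ge0.
under [X in (_ <= X)%E]eq_integral => x _.
  rewrite /= ger0_norm ?Wgh0 //.
  over.
apply: ge0_le_integral => //.
- by move=> x _; rewrite lee_fin powR_ge0.
- by apply/measurable_EFinP; exact: measurable_fun_powR (mW _ _ oA fA).
- apply/measurable_EFinP; apply: measurable_fun_powR.
  by apply: measurable_funD; exact: mW.
move=> x _; rewrite lee_fin (ge0_ler_powR (ltW p0)) ?nnegrE ?indic_abs_ge0 // ?Wgh0 //.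
rewrite /indic_abs -mulrDr indicE; have [xA|_] := boolP (phi x \in A); last by rewrite !mul0r.
by rewrite !mul1r; apply: fgh; rewrite inE in xA.
Qed.

End LpIntegrals.

(** * Exhaustion by compact sets *)

Section Compactness.
Context {R : realType} {n : nat}.
Local Notation C := R[i].
Implicit Types (z w eta : pt R n) (Om A B : set (pt R n)) (f : pt R n -> C).

Lemma cball_open eta (e : R) : 0 < e -> c_open (cball eta e).
Proof.
move=> e0 z ze; have gap : 0 < e ^+ 2 - dist2 z eta by rewrite subr_gt0.
pose S := \sum_(i < n) cabs (z i - eta i).
have S0 : 0 <= S by apply: sumr_ge0 => i _; exact: cabs_ge0.
pose D := 2 * S + n%:R + 1.
have n0 : 0 <= n%:R :> R by [].
have D0 : 0 < D by rewrite /D; lra.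
pose s := Num.min 1 ((e ^+ 2 - dist2 z eta) / D).
have s0 : 0 < s by rewrite lt_min ltr01 divr_gt0.
exists s; split => // w; rewrite -(addpt_sub z w) cball_addpt // => hs.
rewrite addpt_sub /cball /=.
have s1 : s <= 1 by rewrite /s ge_min lexx.
have sD : s * D <= e ^+ 2 - dist2 z eta.
  by rewrite -ler_pdivlMr // /s ge_min lexx orbT.
have hb : dist2 w eta <= dist2 z eta + (2 * s * S + n%:R * s).
  have -> : dist2 z eta + (2 * s * S + n%:R * s) =
      \sum_(i < n) (cabs (z i - eta i) ^+ 2 + (2 * s * cabs (z i - eta i) + s)).
    by rewrite !big_split /= sumr_const card_ord -mulr_sumr (mulr_natl s n).
  apply: ler_sum => i _.
  have hi := le_lt_trans (cabs_le_vabs (fun i => w i - z i) i) hs.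
  have c0 := cabs_ge0 (w i - z i); have a0 := cabs_ge0 (z i - eta i).
  have t : cabs (w i - eta i) <= cabs (z i - eta i) + cabs (w i - z i).
    by rewrite [leRHS]addrC (le_trans _ (cabsD _ _)) // addrA subrK.
  have b0 := cabs_ge0 (w i - eta i).
  move: (cabs (w i - eta i)) (cabs (z i - eta i)) (cabs (w i - z i)) t hi a0 b0 c0.
  move=> b a c t hi a0 b0 c0.
  have h1 : b ^+ 2 <= (a + c) ^+ 2 by rewrite lerXn2r // nnegrE addr_ge0.
  have h2 : c * c <= s * 1 by rewrite ler_pM // ?ltW // (lt_le_trans hi).
  have h3 : a * c <= a * s by rewrite ler_wpM2l // ltW.
  by move: h1; rewrite sqrrD -mulr_natl expr2; lra.
have : 2 * s * S + n%:R * s < s * D.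
  have -> : s * D = 2 * s * S + n%:R * s + s by rewrite /D; ring.
  by rewrite ltrDl.
lra.
Qed.

Lemma c_openI A B : c_open A -> c_open B -> c_open (A `&` B).
Proof.
move=> oA oB z [/oA[r [r0 rA]] /oB[s [s0 sB]]].
exists (Num.min r s); split; first by rewrite lt_min r0.
have m0 : 0 <= Num.min r s by rewrite le_min !ltW.
move=> w wm; split; first by apply: rA; apply: sub_cball wm => //; rewrite ge_min lexx.
by apply: sB; apply: sub_cball wm => //; rewrite ge_min lexx orbT.
Qed.

(** The exhaustion: for [r = 1 / (i + 1)] these sets increase with [i] and cover an open [Om]; they
    are closed, hence compact when [Om] is bounded. *)
Definition inner_set Om (r : R) : set (pt R n) := [set z | cball z r `<=` Om].

Lemma inner_set_closed Om r : 0 < r -> c_open (~` inner_set Om r).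
Proof.
move=> r0 z /existsNP[w /not_implyP[zw Omw]].
have /(cball_open r0)[s [s0 sr]] : cball w r z by rewrite /cball /= dist2C.
exists s; split => // u /sr uw uO; apply: Omw; apply: uO.
by rewrite /cball /= dist2C.
Qed.

(** Real coordinates: compactness and the extreme value theorem are applied to row vectors and
    carried over to [pt R n]. *)
Let psi (v : 'rV[R]_(n + n)) : pt R n :=
  fun i => (v ord0 (lshift n i) +i* v ord0 (rshift n i))%C.

Let psi_nbhs v U : c_open U -> U (psi v) -> nbhs v (psi @^-1` U).
Proof.
move=> oU /oU[r [r0 rU]]; apply/nbhs_ballP.
pose D : R := 4 * (n%:R + 1).
have n0 : 0 <= n%:R :> R by [].
have D0 : 0 < D by rewrite /D; lra.
pose s := Num.min 1 r / D.
have m0 : 0 < Num.min 1 r by rewrite lt_min ltr01.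
have s0 : 0 < s by rewrite divr_gt0.
exists s => // w [_ vw]; apply: rU; rewrite /cball /= /dist2.
have h i : cabs (psi w i - psi v i) ^+ 2 <= (2 * s) ^+ 2.
  have s2 : 0 <= 2 * s by lra.
  suff : cabs (psi w i - psi v i) <= 2 * s by move=> H; rewrite lerXn2r // nnegrE cabs_ge0.
  apply: (le_trans (cabs_leD _)) => /=.
  have := vw ord0 (lshift n i); have := vw ord0 (rshift n i).
  rewrite /ball /= (distrC (v _ _)) => h1; rewrite (distrC (v _ _)) => h2; lra.
have le1 : \sum_(i < n) cabs (psi w i - psi v i) ^+ 2 <= n%:R * (2 * s) ^+ 2.
  by rewrite -[n in n%:R]card_ord -sum1_card natr_sum mulr_suml; apply: ler_sum => i _; rewrite mul1r.
apply: (le_lt_trans le1); apply: (@lt_le_trans _ _ ((s * D) ^+ 2)).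
  have -> : n%:R * (2 * s) ^+ 2 = n%:R * 4 * s ^+ 2 by ring.
  have -> : (s * D) ^+ 2 = D ^+ 2 * s ^+ 2 by ring.
  by rewrite ltr_pM2r ?exprn_gt0 // /D; nra.
have mr : Num.min 1 r <= r by rewrite ge_min lexx orbT.
by rewrite /s divfK ?gt_eqF // lerXn2r // nnegrE ltW.
Qed.

(** A differentiable function is continuous, hence bounded on a compact set. This is what makes a
    small multiple of a singular function uniformly small there. *)
Lemma bounded_on_inner_set Om f (r : R) : c_open Om -> c_bounded Om ->
  holomorphic_on Om f -> 0 < r ->
  exists M : R, forall z, inner_set Om r z -> cabs (f z) <= M.
Proof.
move=> oO [M0 bO] fO r0.
pose K := psi @^-1` inner_set Om r.
have KO v : K v -> Om (psi v) by move=> Kv; apply: Kv; exact: cball_center.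
have cK : compact K.
  pose b := 1 + M0.
  have cB := @rV_compact R (n + n) (fun=> `[- b, b]%classic) (fun=> @segment_compact R _ _).
  apply: (subclosed_compact _ cB).
    rewrite -[K]setCK; apply: open_closedC; rewrite openE => v Kv.
    exact: psi_nbhs (inner_set_closed r0) Kv.
  move=> v /KO/bO h i; rewrite /= in_itv /= -ler_norml.
  have hc j : cabs (psi v j) <= b by exact: coord_le.
  case: (split_ordP i) => j ->.
    by apply: le_trans (hc j); exact: (Re_le_cabs (psi v j)).
  by apply: le_trans (hc j); exact: (Im_le_cabs (psi v j)).
have cf : {within K, continuous (fun v => cabs (f (psi v)))}.
  apply: continuous_in_subspaceT => v; rewrite inE => /KO vO.
  have [a aP] := fO _ vO.
  apply/(@cvgrPdist_lt _ _ _ (nbhs v) (nbhs_filter v)) => e e0.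
  have [s [s0 sP]] := fdiff_continuous aP e0.
  have N := psi_nbhs (cball_open s0) (cball_center (psi v) s0).
  apply: (@filterS _ (nbhs v) (nbhs_filter v) _ _ _ N) => w /= /sP.
  apply: le_lt_trans; rewrite ler_norml.
  have := cabsD (f (psi w) - f (psi v)) (f (psi v)).
  have := cabsD (f (psi v) - f (psi w)) (f (psi w)).
  by rewrite !subrK cabsBC; lra.
have psiK z : psi (row_mx (\row_i re (z i)) (\row_i im (z i))) = z.
  apply/funext => i; rewrite /psi row_mxEl row_mxEr !mxE.
  by case: (z i).
have [K0|/set0P/negP/negPn/eqP K0] := pselect (K !=set0).
  have [c _ cP] := EVT_max_rV K0 cK cf.
  exists (cabs (f (psi c))) => z zO.
  by rewrite -(psiK z); apply: cP; rewrite inE /K /= psiK.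
exists 0 => z zO; have : K (row_mx (\row_i re (z i)) (\row_i im (z i))) by rewrite /K /= psiK.
by rewrite K0.
Qed.

End Compactness.

(** * The function space *)

Section GeometricWeights.
Context {R : realType}.
Implicit Types s : nat -> R.

Let term s k : R := 2 ^- k.+1 * s k.

Let geo (N : nat) : \sum_(0 <= k < N) (2 ^- k.+1 : R) = 1 - 2 ^- N.
Proof.
elim: N => [|N IH]; first by rewrite big_nil expr0 invr1 subrr.
by rewrite big_nat_recr //= IH exprS invfM; lra.
Qed.

(** The first [J] weights add up to less than 1, and the weights after them to at most [2 ^- J]; so
    closeness in finitely many norms already gives closeness in the metric. *)
Lemma weighted_partial s (eta : R) (J : nat) : (forall k, 0 <= s k <= 1) -> 0 <= eta ->
  (forall k, (k < J)%N -> s k <= eta) ->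
  forall N, series (term s) N <= eta + 2 ^- J.
Proof.
move=> s01 eta0 sJ N; rewrite /series /=.
have w0 k : 0 <= 2 ^- k :> R by rewrite invr_ge0 exprn_ge0.
have [NJ|/ltnW JN] := leqP N J.
  apply: (@le_trans _ _ (\sum_(0 <= k < N) 2 ^- k.+1 * eta)).
    apply: ler_sum_nat => k /andP[_ kN]; rewrite ler_wpM2l // sJ //.
    exact: leq_trans NJ.
  rewrite -mulr_suml geo; have := w0 N; have := w0 J; nra.
rewrite (big_cat_nat _ JN) //= lerD //.
  apply: (@le_trans _ _ (\sum_(0 <= k < J) 2 ^- k.+1 * eta)).
    by apply: ler_sum_nat => k /andP[_ kN]; rewrite ler_wpM2l // sJ.
  by rewrite -mulr_suml geo; have := w0 J; nra.
apply: (@le_trans _ _ (\sum_(J <= k < N) 2 ^- k.+1)).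
  apply: ler_sum_nat => k _; rewrite ler_piMr //.
  by have /andP[] := s01 k.
have := geo N; rewrite (big_cat_nat _ JN) //= geo; have := w0 N; lra.
Qed.

Lemma weighted_is_cvg s : (forall k, 0 <= s k <= 1) ->
  {homo series (term s) : a b / (a <= b)%N >-> a <= b} /\ cvgn (series (term s)).
Proof.
move=> s01.
have nd : {homo series (term s) : a b / (a <= b)%N >-> a <= b}.
  move=> a b ab; apply: nondecreasing_series => // k _ _.
  by rewrite mulr_ge0 ?invr_ge0 ?exprn_ge0 //; have /andP[] := s01 k.
split => //; apply: nondecreasing_is_cvgn => //.
exists (1 + 2 ^- 0) => _ [N _ <-].
by apply: weighted_partial => // k; rewrite ltn0.
Qed.

Lemma weighted_le s (eta : R) (J : nat) : (forall k, 0 <= s k <= 1) -> 0 <= eta ->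
  (forall k, (k < J)%N -> s k <= eta) -> limn (series (term s)) <= eta + 2 ^- J.
Proof.
move=> s01 eta0 sJ; have [_ c] := weighted_is_cvg s01.
by apply: limr_le => //; apply: nearW => N; exact: weighted_partial.
Qed.

Lemma weighted_ge s k : (forall k, 0 <= s k <= 1) -> 2 ^- k.+1 * s k <= limn (series (term s)).
Proof.
move=> s01; have [nd c] := weighted_is_cvg s01.
apply: le_trans (nondecreasing_cvgn_le nd c k.+1).
rewrite /series /= big_nat_recr //= lerDr.
apply: sumr_ge0 => i _; rewrite mulr_ge0 ?invr_ge0 ?exprn_ge0 //.
by have /andP[] := s01 i.
Qed.

End GeometricWeights.

Section Exponents.
Context {R : realType}.
Variable q : R.
Hypothesis q1 : 1 < q.

Lemma pseq_ge1 k : 1 <= pseq q k.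
Proof.
rewrite /pseq lerBrDr -lerBrDl.
by rewrite ler_pdivrMr // ler_peMr ?subr_ge0 ?(ltW q1) // ler1n.
Qed.

Lemma pseq_lt k : pseq q k < q.
Proof. by rewrite /pseq ltrBlDr ltrDl divr_gt0 // subr_gt0. Qed.

Lemma pseq_eventually (p : R) : p < q -> exists K, forall k, (K <= k)%N -> p <= pseq q k.
Proof.
move=> pq; have d0 : 0 < q - p by rewrite subr_gt0.
exists (Num.bound ((q - 1) / (q - p))) => k Kk.
have := archi_boundP (divr_ge0 (ltW (_ : 0 < q - 1)) (ltW d0)).
rewrite subr_gt0 => /(_ q1) H.
have : (q - 1) / (q - p) < k.+1%:R.
  by apply: (lt_le_trans H); rewrite ler_nat; exact: leqW.
rewrite ltr_pdivrMr // mulrC -ltr_pdivrMr // => h.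
by rewrite /pseq lerBrDr -lerBrDl ltW.
Qed.

Lemma pseq_cvg : (fun k => pseq q k.+1) @ \oo --> q.
Proof.
apply/cvgrPdist_le => e e0; have [|K KP] := @pseq_eventually (q - e); first by lra.
exists K => // k /= Kk; have h := KP k.+1 (leqW Kk).
by have := pseq_lt k.+1; move: h; rewrite /= ler_norml; lra.
Qed.

End Exponents.

Section FunctionSpace.
Context {R : realType} {n : nat}.
Local Notation C := R[i].
Variables (Om : set (pt R n)) (q : R).
Hypotheses (oO : c_open Om) (bO : c_bounded Om) (q1 : 1 < q).
Implicit Types (A B : set (pt R n)) (f g h phi : pt R n -> C) (p : R).

(** [pseq q 0] is 1, while the exponents of the metric must exceed 1; the shift matches [OLdist]. *)
Let P k := pseq q k.+1.

Let P1 k : 1 <= P k. Proof. exact: pseq_ge1. Qed.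

Let P0 k : 0 < P k. Proof. exact: lt_le_trans (P1 k). Qed.

Let q0 : 0 < q. Proof. exact: lt_trans q1. Qed.

Lemma enorm_lty A p f : (Lp_int A p f < +oo)%E -> (enorm A p f < +oo)%E.
Proof. exact: poweR_lty. Qed.

Lemma enorm_Lp_lty A p f : 0 < p -> (enorm A p f < +oo)%E -> (Lp_int A p f < +oo)%E.
Proof. by move=> p0; apply: lty_poweRy; rewrite invr_eq0 gt_eqF. Qed.

Lemma enorm_le A p f (M : R) : c_open A -> holomorphic_on A f -> 0 < p -> 0 <= M ->
  (enorm A p f <= M%:E)%E = (Lp_int A p f <= (M `^ p)%:E)%E.
Proof.
move=> oA fA p0 M0; have I0 := Lp_int_ge0 oA fA p0.
have MpM : ((M `^ p)%:E `^ p^-1 = M%:E)%E.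
  by rewrite poweR_EFin -powRrM mulfV ?gt_eqF // powRr1.
have IpI : (enorm A p f `^ p = Lp_int A p f)%E.
  by rewrite /enorm -poweRrM mulVf ?gt_eqF // poweRe1.
apply/idP/idP => H.
  rewrite -IpI -poweR_EFin; apply: (gt0_ler_poweR (ltW p0)) => //.
    by rewrite in_itv /= leey andbT; exact: enorm_ge0.
  by rewrite in_itv /= leey andbT lee_fin.
rewrite -MpM /enorm; apply: gt0_ler_poweR => //; first by rewrite invr_ge0 ltW.
  by rewrite in_itv /= leey andbT.
by rewrite in_itv /= leey andbT lee_fin powR_ge0.
Qed.

Lemma enorm_mono A B p f : c_open A -> c_open B -> A `<=` B -> holomorphic_on B f -> 0 < p ->
  (enorm A p f <= enorm B p f)%E.
Proof.
move=> oA oB AB fB p0; apply: gt0_ler_poweR; first by rewrite invr_ge0 ltW.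
- by rewrite in_itv /= leey andbT; apply: Lp_int_ge0 => //; exact: holomorphic_sub fB.
- by rewrite in_itv /= leey andbT; exact: Lp_int_ge0.
- exact: Lp_int_mono.
Qed.

Lemma enorm_subC A p f g : enorm A p (fun z => f z - g z) = enorm A p (fun z => g z - f z).
Proof. by rewrite /enorm (@Lp_int_eq _ _ _ _ _ (fun z => g z - f z)) // => z _; rewrite cabsBC. Qed.

Lemma OLcap_holo f : OLcap Om q f -> holomorphic_on Om f.
Proof. by case. Qed.

Lemma OLcap_fin f k : OLcap Om q f -> enorm Om (P k) f \is a fin_num.
Proof.
move=> [fO fp]; rewrite ge0_fin_numE ?enorm_ge0 //; apply: enorm_lty.
by apply: fp => //; exact: pseq_lt.
Qed.

(** Every [p < q] lies below some [P K], and on a set of finite volume the larger exponent controls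
    the smaller. *)
Lemma OLcapI f : holomorphic_on Om f -> (forall k, (enorm Om (P k) f < +oo)%E) -> OLcap Om q f.
Proof.
move=> fO fP; split => // p p1 pq; have p0 : 0 < p by exact: lt_le_trans p1.
have [V V0 VP] := Lp_int_exponent oO bO.
have [K KP] := pseq_eventually q1 pq.
have pK : p <= P K by apply: KP; exact: leqnSn.
apply: (le_lt_trans (VP Om f p (P K) oO (fun z => id) fO p0 pK)).
by rewrite lte_add_pinfty ?ltry //; apply: enorm_Lp_lty.
Qed.

Lemma OLcap_sub f g : OLcap Om q f -> OLcap Om q g -> OLcap Om q (fun z => f z - g z).
Proof.
move=> fO gO; have [fh gh] := (OLcap_holo fO, OLcap_holo gO).
apply: OLcapI => [|k]; first exact: holomorphic_subr.
have := enorm_triangle oO (P1 k) (holomorphic_subr fh gh) fh gh.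
move=> /(_ (fun z _ => cabsB _ _)) /le_lt_trans; apply.
by rewrite lte_add_pinfty // -ge0_fin_numE ?enorm_ge0 // OLcap_fin.
Qed.

Lemma OLcap_scale f (c : C) : OLcap Om q f -> OLcap Om q (fun z => c * f z).
Proof.
move=> fO; have fh := OLcap_holo fO.
apply: OLcapI => [|k]; first exact: holomorphic_scale.
rewrite enormZ // lte_mul_pinfty ?lee_fin ?cabs_ge0 //.
by rewrite -ge0_fin_numE ?enorm_ge0 // OLcap_fin.
Qed.

Let t f g k := Lp_norm Om (P k) (fun z => f z - g z).

Lemma Lp_normE f p : Lp_norm Om p f = fine (enorm Om p f).
Proof. by rewrite /enorm fine_poweR. Qed.

Let t0 f g k : 0 <= t f g k.
Proof. exact: powR_ge0. Qed.

Let ratio01 f g k : 0 <= t f g k / (1 + t f g k) <= 1.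
Proof.
have h := t0 f g k; have h1 : 0 < 1 + t f g k by lra.
by rewrite divr_ge0 ?(ltW h1) // ler_pdivrMr // mul1r; lra.
Qed.

Lemma OLdist_le f g (eta : R) (J : nat) : 0 <= eta ->
  (forall k, (k < J)%N -> Lp_norm Om (pseq q k.+1) (fun z => f z - g z) <= eta) ->
  OLdist Om q f g <= eta + 2 ^- J.
Proof.
move=> eta0 H; apply: (@weighted_le R (fun k => t f g k / (1 + t f g k))) => //.
move=> k kJ; apply: le_trans (H k kJ); rewrite -/(P k) -/(t f g k).
have h := t0 f g k; have h1 : 0 < 1 + t f g k by lra.
by rewrite ler_pdivrMr //; nra.
Qed.

(** The radius is the [k]-th term of the metric for a norm equal to [d]; a single term is at most
    the whole sum, and [x / (1 + x)] is increasing. *)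
Lemma OLdist_lt_norm f k (d : R) : 0 < d -> exists2 r, 0 < r &
  forall g, OLdist Om q f g < r -> Lp_norm Om (pseq q k.+1) (fun z => f z - g z) < d.
Proof.
move=> d0; have d1 : 0 < 1 + d by lra.
exists (2 ^- k.+1 * (d / (1 + d))); first by rewrite mulr_gt0 ?divr_gt0 // invr_gt0 exprn_gt0.
move=> g H; have := weighted_ge k (ratio01 f g) => H2.
have := le_lt_trans H2 H; rewrite ltr_pM2l ?invr_gt0 ?exprn_gt0 //.
have h := t0 f g k; have h1 : 0 < 1 + t f g k by lra.
by rewrite ltr_pdivrMr // mulrAC ltr_pdivlMr // /t /P; nra.
Qed.

(* Left to right by Fatou along [P k -> q]; right to left because
   [t^p <= 1 + t^q] and [A] has finite volume. *)
Lemma Lp_int_infinite A g : c_open A -> A `<=` Om -> holomorphic_on A g ->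
  (Lp_int A q g = +oo)%E <-> (forall M : nat, exists k, (M%:R%:E < enorm A (P k) g)%E).
Proof.
move=> oA AO gA; split => [gq M|H].
  apply: contrapT => /forallNP H.
  (* The base [1 + M] is at least 1, so its power [P k] is at most its power [q]: Fatou's lemma
     needs a bound independent of [k]. *)
  have MP k : (Lp_int A (P k) g <= ((1 + M%:R) `^ q)%:E)%E.
    have := H k; rewrite ltNge => /negP/negPn; rewrite enorm_le // => /le_trans; apply.
    rewrite lee_fin; apply: (@le_trans _ _ ((1 + M%:R) `^ P k)).
      by rewrite (ge0_ler_powR (ltW (P0 k))) ?nnegrE // lerDr.
    by rewrite ler_powR ?lerDl // ltW // pseq_lt.
  have := Lp_int_fatou_exponent oA gA P0 q0 (pseq_cvg q1) MP.
  by rewrite gq leye_eq.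
apply: contrapT => /eqP; rewrite -ltey => gq.
have [V V0 VP] := Lp_int_exponent oO bO.
have Iq0 := Lp_int_ge0 oA gA q0.
pose K := V + fine (Lp_int A q g).
have K0 : 0 <= K by rewrite addr_ge0 // fine_ge0.
have [k] := H (Num.bound K); rewrite ltNge => /negP; apply.
have KB : K <= (Num.bound K)%:R by rewrite ltW // archi_boundP.
rewrite enorm_le //; apply: (le_trans (VP A g (P k) q oA AO gA (P0 k) (ltW (pseq_lt q1 _)))).
rewrite -[Lp_int A q g]fineK ?ge0_fin_numE // -EFinD lee_fin -/K.
have B1 : 1 <= (Num.bound K)%:R :> R.
  by rewrite ler1n; have : 0 < (Num.bound K)%:R :> R; [rewrite (le_lt_trans K0) // archi_boundP|rewrite ltr0n].
by apply: (le_trans KB); rewrite -[leLHS]powRr1 // ler_powR.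
Qed.

Definition large_norm A (M : R) : set (pt R n -> C) := [set g | exists k, (M%:E < enorm A (P k) g)%E].

(** The exponent that certifies the level for [f] serves for all nearby [g]: a change in the norm of
    [P k] smaller than the gap [d] cannot undo the strict inequality. *)
Lemma large_norm_open A (M : R) : c_open A -> A `<=` Om -> OL_open Om q (large_norm A M).
Proof.
move=> oA AO f fO [k kM].
have fA := OLcap_fin k fO; have fh := OLcap_holo fO.
have eA : (enorm A (P k) f <= enorm Om (P k) f)%E by exact: enorm_mono.
have finA : enorm A (P k) f \is a fin_num.
  by rewrite ge0_fin_numE ?enorm_ge0 // (le_lt_trans eA) // -ge0_fin_numE ?enorm_ge0.
pose d := fine (enorm A (P k) f) - M.
have d0 : 0 < d by rewrite subr_gt0 -lte_fin fineK.
have [r r0 rP] := OLdist_lt_norm f k d0; exists r; split => // g gO /rP; rewrite Lp_normE => H.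
have gh := OLcap_holo gO; have fgO := OLcap_sub fO gO.
exists k.
have tri := enorm_triangle oA (P1 k) (holomorphic_sub AO fh) (holomorphic_sub AO gh)
  (holomorphic_sub AO (OLcap_holo fgO)).
have {}tri : (enorm A (P k) f <= enorm A (P k) g + enorm A (P k) (fun z => (f z - g z)%R))%E.
  by apply: tri => z _; rewrite -[f z in leLHS](subrK (g z)) addrC cabsD.
have hA : (enorm A (P k) (fun z => (f z - g z)%R) < d%:E)%E.
  apply: (@le_lt_trans _ _ (enorm Om (P k) (fun z => (f z - g z)%R))).
    by apply: enorm_mono => //; exact: OLcap_holo.
  by rewrite -[X in (X < _)%E]fineK ?OLcap_fin // lte_fin.
have ME : (M%:E = enorm A (P k) f - d%:E)%E.
  by rewrite -[enorm A (P k) f]fineK // -EFinB /d opprB addrC subrK.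
rewrite ME lteBlDr //; apply: (le_lt_trans tri).
have gA : enorm A (P k) g \is a fin_num.
  rewrite ge0_fin_numE ?enorm_ge0 //; apply: (@le_lt_trans _ _ (enorm Om (P k) g)).
    exact: enorm_mono.
  by rewrite -ge0_fin_numE ?enorm_ge0 // OLcap_fin.
by rewrite lteD2lE.
Qed.

End FunctionSpace.

(** * Singular functions *)

Section SingularFunctions.
Context {R : realType} {n : nat}.
Local Notation C := R[i].
Variables (Om : set (pt R n)) (q : R).
Hypotheses (oO : c_open Om) (bO : c_bounded Om) (q1 : 1 < q).
Hypothesis sing : forall eta, c_boundary Om eta -> forall eps : R, 0 < eps ->
  exists f, OLcap Om q f /\ Lp_int (cball eta eps `&` Om) q f = +oo%E.
Implicit Types (A B : set (pt R n)) (f g phi : pt R n -> C).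

Let P k := pseq q k.+1.

Let P1 k : 1 <= P k. Proof. exact: pseq_ge1. Qed.

Let P0 k : 0 < P k. Proof. exact: lt_le_trans (P1 k). Qed.

Let q0 : 0 < q. Proof. exact: lt_trans q1. Qed.

Let box k : set (pt R n) := rbox k `&` Om.

Let meets k := exists zeta, c_boundary Om zeta /\ (@rbox R n k) zeta.

Let box_open k : c_open (box k).
Proof.
by apply: c_openI => // z /rbox_open[r r0 rk]; exists r.
Qed.

Let box_sub k : box k `<=` Om. Proof. by move=> z []. Qed.

Let ball_open eta (e : R) : 0 < e -> c_open (cball eta e `&` Om).
Proof. by move=> e0; apply: c_openI => //; exact: cball_open. Qed.

(** A box meeting the boundary contains a ball around a boundary point, and each ball around a
    boundary point contains a box through that point; larger sets have larger integrals. *)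
Lemma Sset_boxes g : OLcap Om q g -> Sset Om q g <->
  forall k, meets k -> forall M : nat, large_norm q (box k) M%:R g.
Proof.
move=> gO; have gh := OLcap_holo gO.
have inf k := Lp_int_infinite oO bO q1 (@box_open k) (@box_sub k) (holomorphic_sub (@box_sub k) gh).
split => [[_ gS] k [zeta [zb zk]] M|H].
  suff : Lp_int (box k) q g = +oo%E by move/inf; exact.
  have [r r0 rk] := rbox_open zk.
  apply/eqP; rewrite -leye_eq -(gS zeta zb r r0); apply: Lp_int_mono => //.
  - exact: ball_open.
  - by move=> z [/rk zr Oz].
  - exact: holomorphic_sub gh.
split => // zeta zb e e0; have [k [kz ke]] := rbox_base (cball_open e0) (cball_center zeta e0).
apply/eqP; rewrite -leye_eq.
have <- : Lp_int (box k) q g = +oo%E by apply/inf => M; apply: H; exists zeta.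
apply: Lp_int_mono => //; first exact: ball_open.
  by move=> z [/ke ze Oz].
by apply: holomorphic_sub gh => z [].
Qed.

Lemma Sset_Gdelta : OL_Gdelta Om q (Sset Om q).
Proof.
exists (fun i => if unpickle i is Some kM then
   [set g | meets kM.1 -> large_norm q (box kM.1) kM.2%:R g] else setT); split.
  move=> i; case: unpickle => [[k M]|] f fO /= fU; last by exists 1.
  have [mk|nmk] := pselect (meets k); last by exists 1; split => // g _ _ /nmk.
  have [r [r0 rP]] := large_norm_open oO bO q1 (@box_open k) (@box_sub k) fO (fU mk).
  by exists r; split => // g gO fg _; exact: rP.
apply/seteqP; split => g.
  move=> gS; have gO := gS.1; split => // i.
  by case: unpickle => [[k M]|//] /= mk; have := (Sset_boxes gO).1 gS; exact.
move=> [gO H]; apply/(Sset_boxes gO) => k mk M.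
by have := H (pickle (k, M)); rewrite pickleK /=; exact.
Qed.

Lemma enorm_self A p g : c_open A -> holomorphic_on A g -> 0 < p ->
  enorm A p (fun z => g z - g z) = 0%E.
Proof.
move=> oA gA p0; rewrite (_ : (fun z => _) = (fun z => 0 * g z)).
  by rewrite enormZ // cabs0 mul0e.
by apply/funext => z; rewrite subrr mul0r.
Qed.

(** If [g] is already singular on [A], it is kept. Otherwise [g + c phi] is singular for every
    [c > 0], since a finite norm of it and of [g] would make that of [phi] finite; [c] is free to be
    small. *)
Lemma perturb A phi g (e r : R) (m : nat) : c_open A -> A `<=` Om -> OLcap Om q phi ->
  Lp_int A q phi = +oo%E -> OLcap Om q g -> 0 < e -> 0 < r ->
  exists g', [/\ OLcap Om q g',
    forall k, (k <= m)%N -> (enorm Om (P k) (fun z => (g' z - g z)%R) <= e%:E)%E,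
    forall z, inner_set Om r z -> cabs (g' z - g z) <= e &
    Lp_int A q g' = +oo%E].
Proof.
move=> oA AO phiO phiA gO e0 r0; have gh := OLcap_holo gO; have ph := OLcap_holo phiO.
have [gA|gA] := eqVneq (Lp_int A q g) +oo%E.
  exists g; split => // [k _|z _]; first by rewrite enorm_self ?lee_fin ?ltW.
  by rewrite subrr cabs0 ltW.
have [S SP] := bounded_on_inner_set oO bO ph r0.
have [i|c0 c00 c0P] := @common_lower_bound R 'I_m.+1 (fun k => e / (1 + fine (enorm Om (P k) phi))).
  by rewrite divr_gt0 // ltr_pwDl // fine_ge0 // enorm_ge0.
(* [c0] handles the norms with index at most [m], the other term the supremum on the inner set;
   adding 1 in the denominators avoids division by zero. *)
pose c := Num.min c0 (e / (1 + `|S|)).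
have cpos : 0 < c by rewrite lt_min c00 divr_gt0 // ltr_pwDl.
have cS : c * (1 + `|S|) <= e by rewrite -ler_pdivlMr ?ltr_pwDl // /c ge_min lexx orbT.
have cc : cabs (c%:C)%C = c by rewrite cabs_real ger0_norm ?ltW.
have sO := OLcap_scale oO bO q1 (- c%:C)%C phiO.
pose g' z := g z - (- c%:C)%C * phi z.
have g'O : OLcap Om q g' by exact: OLcap_sub.
have g'gE z : g' z - g z = (c%:C)%C * phi z by rewrite /g'; ring.
exists g'; split => //.
- move=> k km; rewrite (_ : (fun z => _) = (fun z => (c%:C)%C * phi z)); last exact/funext.
  rewrite enormZ // cc -[enorm _ _ _]fineK; last exact: OLcap_fin.
  rewrite -EFinM lee_fin; have km1 : (k < m.+1)%N by [].
  have := c0P (Ordinal km1); rewrite /= ler_pdivlMr; last first.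
    by rewrite ltr_pwDl // fine_ge0 // enorm_ge0.
  apply: le_trans; apply: ler_pM; first exact: ltW.
  + by rewrite fine_ge0 // enorm_ge0.
  + by rewrite /c ge_min lexx.
  + by rewrite lerDr.
- move=> z /SP zS; rewrite g'gE cabsM cc; apply: le_trans cS.
  by rewrite ler_wpM2l ?(ltW cpos) //; have := ler_norm S; lra.
apply: contrapT => /eqP; rewrite -ltey => g'A.
have pA : (enorm A q (fun z => ((c%:C)%C * phi z)%R) < +oo)%E.
  have tri := enorm_triangle oA (ltW q1) (holomorphic_scale (c%:C)%C (holomorphic_sub AO ph))
    (holomorphic_sub AO (OLcap_holo g'O)) (holomorphic_sub AO gh).
  apply: (le_lt_trans (tri _)) => [z _|]; first by rewrite -g'gE cabsB.
  by rewrite lte_add_pinfty // enorm_lty // ltey.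
move: pA; rewrite enormZ //; last exact: holomorphic_sub ph.
have -> : enorm A q phi = +oo%E by rewrite /enorm phiA poweRyr // invr_eq0 gt_eqF.
by rewrite cc gt0_muley ?lte_fin // ltxx.
Qed.

(** * The approximating sequence and its limit *)

Section Construction.
Variable d : R.
Hypotheses (d0 : 0 < d) (d1 : d <= 1).

(* Stage [i] treats the pair (box, level) with code [i]. The exponents up to
   the index [s.2], which certify the levels reached so far, are protected. *)
Definition next_stage (i : nat) (s s' : (pt R n -> C) * nat) : Prop :=
  [/\ OLcap Om q s'.1, (s.2 < s'.2)%N,
      forall k, (k <= s.2)%N -> (enorm Om (P k) (fun z => (s'.1 z - s.1 z)%R) <= (d / 2 ^+ i.+1)%:E)%E,
      forall z, inner_set Om i.+1%:R^-1 z -> cabs (s'.1 z - s.1 z) <= 2 ^- i.+1 &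
      forall k M, unpickle i = Some (k, M) -> meets k ->
        exists2 j, (j <= s'.2)%N & ((M.+1%:R)%:E < enorm (box k) (P j) s'.1)%E].

Lemma next_stage_exists i s : OLcap Om q s.1 -> exists s', next_stage i s s'.
Proof.
case: s => g m /= gO; have gh := OLcap_holo gO.
pose e := d / 2 ^+ i.+1.
have e0 : 0 < e by rewrite divr_gt0 // exprn_gt0.
have e2 : e <= 2 ^- i.+1 by rewrite /e ler_piMl // invr_ge0 exprn_ge0.
have r0 : 0 < i.+1%:R^-1 :> R by rewrite invr_gt0.
have triv : (forall (k : @box_index n) (M : nat), unpickle i = Some (k, M) -> ~ meets k) -> exists s', next_stage i (g, m) s'.
  (* A stage with no task keeps the function but still enlarges the protected range. *)
  move=> H; exists (g, m.+1); split => //=.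
  - by move=> k _; rewrite enorm_self // lee_fin ltW.
  - by move=> z _; rewrite subrr cabs0 invr_ge0 exprn_ge0.
  - by move=> k M kM mk; case: (H k M kM mk).
case E : (unpickle i : option (@box_index n * nat)) => [[k M]|]; last by apply: triv => k M; rewrite E.
have [mk|nmk] := pselect (meets k); last first.
  by apply: triv => k' M'; rewrite E => -[<- _].
have [zeta [zb zk]] := mk.
have [r rpos rk] := rbox_open zk.
have [phi [phiO phiA]] := sing zb rpos.
have phiB : Lp_int (box k) q phi = +oo%E.
  apply/eqP; rewrite -leye_eq -phiA; apply: Lp_int_mono => //; first exact: ball_open.
    by move=> z [/rk zr Oz].
  by apply: holomorphic_sub (OLcap_holo phiO) => z [].
have [g' [g'O g'e g'K g'B]] := perturb m (@box_open k) (@box_sub k) phiO phiB gO e0 r0.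
have [j jP] := (Lp_int_infinite oO bO q1 (@box_open k) (@box_sub k)
   (holomorphic_sub (@box_sub k) (OLcap_holo g'O))).1 g'B M.+1.
(* At least [j], to protect the exponent certifying the new level, and at least [m.+1], so that
   every exponent is protected eventually. *)
exists (g', maxn m.+1 j); split => //=.
- by rewrite leq_maxl.
- by move=> z /g'K /le_trans; apply.
move=> k' M'; rewrite E => -[<- <-] _; exists j => //; exact: leq_maxr.
Qed.

Variables (f : pt R n -> C) (J : nat).
Hypothesis fO : OLcap Om q f.

Lemma stages_exist : exists s : nat -> (pt R n -> C) * nat, [/\ s 0%N = (f, J),
  forall i, OLcap Om q (s i).1 & forall i, next_stage i (s i) (s i.+1)].
Proof.
have ex (p : nat * ((pt R n -> C) * nat)) : exists s', OLcap Om q p.2.1 -> next_stage p.1 p.2 s'.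
  have [sO|nO] := pselect (OLcap Om q p.2.1); last by exists p.2.
  by have [s' s'P] := next_stage_exists p.1 sO; exists s'.
have [F FP] := choice ex.
pose s := fix s i := if i is i'.+1 then F (i', s i') else (f, J).
have sO i : OLcap Om q (s i).1.
  by elim: i => [//|i IH]; have [] := FP (i, s i) IH.
by exists s; split => // i; exact: (FP (i, s i) (sO i)).
Qed.

Variable s : nat -> (pt R n -> C) * nat.
Hypotheses (s0 : s 0%N = (f, J)) (sO : forall i, OLcap Om q (s i).1)
  (sS : forall i, next_stage i (s i) (s i.+1)).

Let g i := (s i).1.
Let m i := (s i).2.

Let gh i : holomorphic_on Om (g i). Proof. exact: OLcap_holo (sO i). Qed.

Let m_mono a b : (a <= b)%N -> (m a <= m b)%N.
Proof.
move=> /subnK <-; elim: (b - a)%N => [//|k IH]; rewrite addSn (leq_trans IH) //.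
by apply: ltnW; have [] := sS (k + a).
Qed.

Let m_ge a : (a <= m a)%N.
Proof.
elim: a => [//|a IH]; apply: leq_ltn_trans IH _.
by have [] := sS a.
Qed.

Let inner_mono a b z : (a <= b)%N -> inner_set Om a.+1%:R^-1 z -> inner_set Om b.+1%:R^-1 z.
Proof.
move=> ab; apply: subset_trans; apply: sub_cball; first by rewrite invr_ge0.
by rewrite lef_pV2 ?posrE // ler_nat.
Qed.

Let halves k : 2 ^- k = 2 ^- k.+1 + 2 ^- k.+1 :> R.
Proof. by rewrite exprS invfM; lra. Qed.

Let half_ge0 k : 0 <= 2 ^- k :> R. Proof. by rewrite invr_ge0 exprn_ge0. Qed.

Let g_cauchy a b z : (a <= b)%N -> inner_set Om a.+1%:R^-1 z ->
  cabs (g b z - g a z) <= 2 ^- a.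
Proof.
(* The sharper bound [2 ^- a - 2 ^- b] telescopes and carries the induction; the point stays in the
   inner sets of all later stages, as these increase. *)
move=> ab za; suff : cabs (g b z - g a z) <= 2 ^- a - 2 ^- b by have := half_ge0 b; lra.
rewrite -(subnK ab); elim: (b - a)%N => [|k IH]; first by rewrite subrr cabs0 subrr.
have zk : inner_set Om (k + a).+1%:R^-1 z by apply: inner_mono za; exact: leq_addl.
have [_ _ _ /(_ z zk) h _] := sS (k + a).
rewrite addSn -(subrK (g (k + a)%N z) (g (k + a).+1 z)) -addrA (le_trans (cabsD _ _)) //.
by have := halves (k + a); rewrite -/(g _) -/(g _) in h *; lra.
Qed.

(** An index protected at stage [a] stays protected, so the later changes in its norm form a
    geometric series, summed as in [g_cauchy]. *)
Let norm_cauchy a b j : (a <= b)%N -> (j <= m a)%N ->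
  (enorm Om (P j) (fun z => (g b z - g a z)%R) <= (d * 2 ^- a)%:E)%E.
Proof.
move=> ab ja.
suff : (enorm Om (P j) (fun z => (g b z - g a z)%R) <= (d * (2 ^- a - 2 ^- b))%:E)%E.
  move=> /le_trans; apply; rewrite lee_fin ler_wpM2l ?(ltW d0) //.
  by have := half_ge0 b; lra.
rewrite -(subnK ab); elim: (b - a)%N => [|k IH].
  by rewrite enorm_self // add0n subrr mulr0.
have jk : (j <= m (k + a))%N by apply: leq_trans ja (m_mono (leq_addl _ _)).
have [_ _ /(_ j jk) h _ _] := sS (k + a).
have tri := enorm_triangle oO (P1 j) (holomorphic_subr (gh (k + a).+1) (gh a))
  (holomorphic_subr (gh (k + a).+1) (gh (k + a))) (holomorphic_subr (gh (k + a)) (gh a)).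
rewrite addSn; apply: (le_trans (tri _)) => [z _|].
  rewrite -{1}(subrK (g (k + a)%N z) (g (k + a).+1 z)) -addrA; exact: cabsD.
apply: (le_trans (leeD h IH)); rewrite -EFinD lee_fin.
have -> : d / 2 ^+ (k + a).+1 + d * (2 ^- a - 2 ^- (k + a)) =
   d * (2 ^- (k + a).+1 + (2 ^- a - 2 ^- (k + a))) by ring.
by rewrite ler_wpM2l ?(ltW d0) // (halves (k + a)); lra.
Qed.

(** A whole ball around [z] lies in one member of the exhaustion; this makes the convergence locally
    uniform. *)
Let inner_ex z : Om z -> exists2 r : R, 0 < r & exists a : nat,
  forall w, cball z r w -> inner_set Om a.+1%:R^-1 w.
Proof.
move=> /oO[r [r0 rO]]; have r2 : 0 < r / 2 by lra.
exists (r / 2) => //; exists (Num.bound (r / 2)^-1) => w wz.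
apply: subset_trans rO; apply: subset_trans (cball_half r0 wz).
apply: sub_cball; first by rewrite invr_ge0.
rewrite -[leRHS]invrK lef_pV2 ?posrE ?invr_gt0 //.
have /ltW : (r / 2)^-1 < (Num.bound (r / 2)^-1)%:R by rewrite archi_boundP // invr_ge0 ltW.
by move=> /le_trans; apply; rewrite ler_nat.
Qed.

Lemma limit_exists : exists G : pt R n -> C, forall z a,
  inner_set Om a.+1%:R^-1 z -> cabs (G z - g a z) <= 4 * 2 ^- a.
Proof.
suff /choice[G GP] : forall z, exists l, forall a, inner_set Om a.+1%:R^-1 z ->
  cabs (l - g a z) <= 4 * 2 ^- a by exists G.
move=> z.
have [[a0 za0]|noa] := pselect (exists a, inner_set Om a.+1%:R^-1 z); last first.
  (* No inner set contains [z], so nothing is required of the value there. *)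
  by exists 0 => a za; case: noa; exists a.
(* The sequence is controlled only from a stage [a0] whose inner set contains [z]. For another [a]
   the comparison goes through stage [a0 + a]: at most [2 * 2 ^- a] from the limit and [2 ^- a] from
   [g_cauchy]. *)
have [k b kb|l lP] := @complex_cauchy R (fun k => g (a0 + k)%N z) (fun k => 2 ^- (a0 + k)).
  apply: g_cauchy; first by rewrite leq_add2l.
  by apply: inner_mono za0; exact: leq_addr.
exists l => a za; pose b := (a0 + a)%N.
have ab : (a <= b)%N by exact: leq_addl.
have := cabsD (l - g b z) (g b z - g a z); rewrite addrA subrK.
have := lP a; rewrite -/b; have := g_cauchy ab za.
have : 2 ^- b <= 2 ^- a :> R by rewrite lef_pV2 ?posrE ?exprn_gt0 // ler_weXn2l // ler1n.
have := half_ge0 a; lra.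
Qed.

Variable G : pt R n -> C.
Hypothesis GP : forall z a, inner_set Om a.+1%:R^-1 z -> cabs (G z - g a z) <= 4 * 2 ^- a.

Let half_small (e : R) : 0 < e -> exists N, forall k, (N <= k)%N -> 2 ^- k < e.
Proof.
move=> e0; exists (Num.bound e^-1) => k Nk.
have B := archi_boundP (ltW (_ : 0 < e^-1)); rewrite invr_gt0 in B.
rewrite -[ltRHS]invrK ltf_pV2 ?posrE ?invr_gt0 ?exprn_gt0 //.
apply: (lt_le_trans (B e0)); rewrite -natrX ler_nat (leq_trans Nk) //.
by rewrite ltnW // ltn_expl.
Qed.

Let G_holo : holomorphic_on Om G.
Proof.
move=> z /[dup] zO /inner_ex[r r0 [a ra]].
have rO : cball z r `<=` Om.
  by move=> w /ra; apply; apply: cball_center; rewrite invr_gt0.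
apply: (@weierstrass R n Om (fun k => g (a + k)%N) G z r (fun k => 2 * 2 ^- (a + k))) => //.
- move=> e e0; have [|N NP] := @half_small (e / 2); first by lra.
  exists N => k Nk; have := NP (a + k)%N (leq_trans Nk (leq_addl _ _)); lra.
- move=> k b kb w /ra wa; apply: (@le_trans _ _ (2 ^- (a + k))).
    apply: g_cauchy; first by rewrite leq_add2l.
    by apply: inner_mono wa; exact: leq_addr.
  by have := half_ge0 (a + k); lra.
move=> k w /ra wa; have := @GP w (a + k)%N; rewrite mulrA -natrM; apply.
by apply: inner_mono wa; exact: leq_addr.
Qed.

(** Fatou's lemma carries [norm_cauchy] over to the limit, since the convergence is pointwise on
    [Om]. *)
Let G_norm a j : (j <= m a)%N ->
  (enorm Om (P j) (fun z => (G z - g a z)%R) <= (d * 2 ^- a)%:E)%E.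
Proof.
move=> ja; have da : 0 <= d * 2 ^- a by rewrite mulr_ge0 // ltW.
rewrite (enorm_le oO) //; last exact: holomorphic_subr.
apply: (@Lp_int_fatou R n Om (P j) (fun k z => g (a + k)%N z - g a z)) => //.
- by move=> k; exact: holomorphic_subr.
- exact: holomorphic_subr.
- move=> z zO; have [r r0 [b bP]] := inner_ex zO.
  have zb := bP z (cball_center z r0).
  apply/cvgrPdist_lt => e e0; have [|N NP] := @half_small (e / 4); first by lra.
  exists (N + b)%N => // k /= Nbk.
  have bk : (b <= a + k)%N by lia.
  have := GP (inner_mono bk zb); have := NP (a + k)%N ltac:(lia).
  have := cabsD (G z - g (a + k)%N z) (g (a + k)%N z - g a z); rewrite addrA subrK.
  have := cabsD (g (a + k)%N z - G z) (G z - g a z); rewrite addrA subrK.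
  rewrite (cabsBC (g (a + k)%N z) (G z)) ltr_norml; lra.
move=> k; rewrite -(enorm_le oO) //; last exact: holomorphic_subr.
by apply: norm_cauchy => //; exact: leq_addr.
Qed.

Let G_OLcap : OLcap Om q G.
Proof.
(* Index [k] is protected from stage [k] on, so [G] is at finite distance from [g k] in the norm of
   [P k]. *)
apply: OLcapI => // k; have := G_norm (m_ge k) => Gk.
have tri := enorm_triangle oO (P1 k) G_holo (holomorphic_subr G_holo (gh k)) (gh k).
apply: (le_lt_trans (tri _)) => [z _|].
  by rewrite -{1}(subrK (g k z) (G z)) cabsD.
rewrite lte_add_pinfty //; first exact: le_lt_trans Gk (ltry _).
by rewrite -ge0_fin_numE ?enorm_ge0 //; exact: OLcap_fin (sO k).
Qed.

(** The stage with the code of the pair certifies level [M + 1] at an exponent protected from then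
    on. All later changes in that norm add up to at most 1, because [d <= 1], so level [M] survives
    in the limit. *)
Lemma limit_in_Sset : Sset Om q G.
Proof.
apply/(Sset_boxes G_OLcap) => k mk M; pose i := pickle (k, M).
have [_ _ _ _ /(_ k M)] := sS i; rewrite pickleK => /(_ erefl mk)[j jm jM].
exists j; rewrite -/(P j).
have hb u : holomorphic_on Om u -> holomorphic_on (box k) u by exact: holomorphic_sub.
have tri := enorm_triangle (@box_open k) (P1 j) (hb _ (gh i.+1)) (hb _ G_holo)
  (hb _ (holomorphic_subr G_holo (gh i.+1))).
have {}tri : (enorm (box k) (P j) (g i.+1) <=
   enorm (box k) (P j) G + enorm (box k) (P j) (fun z => (G z - g i.+1 z)%R))%E.
  apply: tri => z _; rewrite [leRHS]addrC cabsBC.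
  by rewrite -[g i.+1 z in leLHS](subrK (G z)) cabsD.
have small : (enorm (box k) (P j) (fun z => (G z - g i.+1 z)%R) <= 1%:E)%E.
  apply: (@le_trans _ _ (enorm Om (P j) (fun z => (G z - g i.+1 z)%R))).
    by apply: enorm_mono => //; exact: holomorphic_subr.
  apply: (le_trans (G_norm jm)); rewrite lee_fin.
  have : 2 ^- i.+1 <= 1 :> R by rewrite invf_le1 ?exprn_gt0 // exprn_ege1 // ler1n.
  by have := half_ge0 i.+1; have := d0; have := d1; nra.
have := lt_le_trans jM (le_trans tri (leeD2l _ small)).
by rewrite -natr1 EFinD lteD2rE.
Qed.

(** The construction starts with the indices up to [J] protected, so the first [J] norms of the
    metric are at most [d]; the tail contributes at most [2 ^- J]. *)
Lemma limit_close : OLdist Om q f G <= d + 2 ^- J.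
Proof.
apply: OLdist_le => //; first exact: ltW.
move=> k kJ; have kJ' : (k <= m 0)%N by rewrite /m s0 /= ltnW.
have := G_norm kJ'; rewrite expr0 invr1 mulr1 /g s0 /= => h.
rewrite Lp_normE enorm_subC -lee_fin fineK //.
rewrite ge0_fin_numE ?enorm_ge0 //; exact: le_lt_trans h (ltry _).
Qed.

End Construction.

Lemma Sset_dense : OL_dense Om q (Sset Om q).
Proof.
split=> [g []//|f fO e e0].
pose d := Num.min 1 (e / 4).
have d0 : 0 < d by rewrite lt_min ltr01 divr_gt0.
have d1 : d <= 1 by rewrite /d ge_min lexx.
have d4 : d <= e / 4 by rewrite /d ge_min lexx orbT.
pose J := Num.bound (4 / e).
have JP : 2 ^- J < e / 4.
  rewrite -[ltRHS]invrK ltf_pV2 ?posrE ?invr_gt0 ?exprn_gt0 ?divr_gt0 // invf_div.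
  apply: (lt_le_trans (archi_boundP _)); first by rewrite divr_ge0 // ltW.
  by rewrite -natrX ler_nat ltnW // ltn_expl.
have [s [s0 sO sS]] := stages_exist d0 d1 J fO.
have [G GP] := limit_exists sS.
exists G; split; first exact: (limit_in_Sset d0 d1 sO sS GP).
by apply: (le_lt_trans (limit_close d0 d1 s0 sO sS GP)); lra.
Qed.

End SingularFunctions.

Theorem theorem6 (R : realType) (n : nat) (Om : set (pt R n)) (q : R) :
  c_open Om -> c_bounded Om -> 1 < q ->
  (forall eta, c_boundary Om eta -> forall eps : R, 0 < eps ->
     exists f, OLcap Om q f /\ Lp_int (cball eta eps `&` Om) q f = +oo%E) ->
  OL_dense Om q (Sset Om q) /\ OL_Gdelta Om q (Sset Om q).
Proof.
move=> oO bO q1 sing; split; first exact: Sset_dense.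
exact: Sset_Gdelta.
Qed.
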